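(* Let $R$ be a Dedekind ring with quotient field $K$, let $L$ be a finite separable extension of $K$, let $O_L$ be the integral closure of $R$ in $L$, let $\alpha\in O_L$ with $L=K(\alpha)$, let $P\in R[X]$ be the minimal polynomial of $\alpha$ over $K$, and let $A=R[\alpha]$. Let $\mathfrak p$ be a nonzero prime ideal of $R$, and let $\overline{P}=\prod_{i=1}^r \overline{P_i}^{\,l_i}$ be the factorization of the reduction $\overline P$ of $P$ modulo $\mathfrak p$ into powers of distinct monic irreducible polynomials $\overline{P_i}\in (R/\mathfrak p)[X]$, and let $P_i\in R[X]$ be a monic lift of $\overline{P_i}$ for each $i$. Suppose that $T\in R[X]$ has nonzero reduction $\overline T$ modulo $\mathfrak p$ and that $P=\prod_{i=1}^r P_i^{l_i}+aT$ for some $a\in\mathfrak p\setminus\mathfrak p^2$. Let $t_i$ be the largest integer such that $\overline{P_i}^{\,t_i}$ divides $\overline T$, and set $s_i=\min\{\lfloor l_i/2\rfloor, t_i\}$. Then $$\nu_{\mathfrak p}(\mathrm{Ind}_R(P))\ \ge\ \sum_{i=1}^r s_i\deg(P_i)\;=\;\deg\Big(\prod_{i=1}^r P_i^{s_i}\Big).$$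
   Context: For a discrete valuation ring $S$ with maximal ideal $\mathfrak m$ and a finitely generated $S$-module $M$, the order ideal $\mathrm{ord}_S(M)$ is $S$ if $M=0$, $0$ if $M$ is not torsion, and $\mathfrak m^t$ if $M$ is a nonzero torsion module, where $t$ is the length of $M$ (the length of a composition series, all of whose factors are isomorphic to $S/\mathfrak m$). For $N\subseteq M$ projective modules of the same finite constant rank, $[M:N]_S=\mathrm{ord}_S(M/N)$. The index $\mathrm{Ind}_R(P)$ of $P$ over the Dedekind ring $R$ is the ideal of $R$ obtained by generalizing $[O_L:R[\alpha]]$ to Dedekind rings; for a nonzero prime $\mathfrak p$, $\nu_{\mathfrak p}(\mathrm{Ind}_R(P))$ is the exponent $t$ with $[O_L\otimes R_{\mathfrak p}:R_{\mathfrak p}[\alpha]]_{R_{\mathfrak p}}=(\mathfrak pR_{\mathfrak p})^t$, i.e. the $R_{\mathfrak p}$-length of $(O_L/R[\alpha])_{\mathfrak p}$. These indices satisfy $\mathrm{disc}(P)R=\mathrm{Ind}_R(P)^2D_R(O_L)$ with $D_R(O_L)$ the relative discriminant. *)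

(* Defs.v *)
From HB Require Import structures.
From mathcomp Require Import all_boot all_order all_algebra all_field.
From mathcomp Require Import ring_quotient generic_quotient fraction.
From mathcomp Require Import boolp classical_sets.

Set Implicit Arguments.
Unset Strict Implicit.
Unset Printing Implicit Defensive.

Import GRing.Theory.

Local Open Scope ring_scope.
Local Open Scope quotient_scope.
Local Open Scope classical_set_scope.

(* Ideals of R are the (proper, boolean) ideals of [ring_quotient]; by the      *)
(* classical axioms of [boolp] every proper ideal is of this form.             *)

Section Dedekind.
Variable R : idomainType.

Definition finitely_generated_ideal (I : idealr R) : Prop :=
  exists s : seq R, forall x : R,
    x \in I <-> exists c : 'I_(size s) -> R, x = \sum_i c i * s`_i.

Definition maximal_ideal (p : idealr R) : Prop :=
  forall I : idealr R, {subset p <= I} -> {subset I <= p}.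

Definition nonzero_ideal (p : idealr R) : Prop :=
  exists2 x : R, x \in p & x != 0.

Record dedekind : Prop := {
  dedekind_noetherian : forall I : idealr R, finitely_generated_ideal I;
  dedekind_integrally_closed : forall x : {fraction R},
    integralOver (@tofrac R) x -> exists r : R, x = tofrac r;
  dedekind_maximal : forall p : prime_idealr R,
    nonzero_ideal p -> maximal_ideal p }.

End Dedekind.

Definition residue_field (R : idomainType) (p : prime_idealr R)
  (pmax : maximal_ideal p) : Type := {ideal_quot p}.

Section ResidueField.
Variables (R : idomainType) (p : prime_idealr R) (pmax : maximal_ideal p).

Local Notation k := (residue_field pmax).

HB.instance Definition _ := GRing.ComNzRing.copy k {ideal_quot p}.

Definition residue : R -> k := \pi_({ideal_quot p}).

Fact residue_is_zmod_morphism : zmod_morphism residue.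
Proof. by move=> x y; rewrite /residue; exact: rmorphB. Qed.
Fact residue_is_monoid_morphism : monoid_morphism residue.
Proof.
by rewrite /residue; split=> [|x y]; [exact: rmorph1 | exact: rmorphM].
Qed.
HB.instance Definition _ :=
  GRing.isZmodMorphism.Build R k residue residue_is_zmod_morphism.
HB.instance Definition _ :=
  GRing.isMonoidMorphism.Build R k residue residue_is_monoid_morphism.

Lemma residue_surj (x : k) : exists r, x = residue r.
Proof. by exists (repr (x : {ideal_quot p})); rewrite /residue reprK. Qed.

Lemma residue_eq0 (r : R) : (residue r == 0) = (r \in p).
Proof.
have -> : (0 : k) = residue 0 by rewrite rmorph0.
by rewrite -[r in RHS]subr0 Quotient.idealrBE.
Qed.

Section Inverse.
Variables (x : R) (xp : x \notin p).

Let I : {pred R} := [pred z | `[< exists a, z - a * x \in p >]].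

Let inI z : z \in I = `[< exists a, z - a * x \in p >].
Proof. by []. Qed.

Fact residue_inv_subproof : exists a, 1 - a * x \in p.
Proof.
apply: contrapT => noinv.
have Iid : idealr_closed I.
  split; rewrite ?inI.
  - by apply/asboolP; exists 0; rewrite mul0r subr0 idealr0.
  - by apply/asboolP /noinv.
  move=> b u v; rewrite !inI => /asboolP[a1 h1] /asboolP[a2 h2].
  apply/asboolP; exists (b * a1 + a2).
  have -> : b * u + v - (b * a1 + a2) * x
    = b * (u - a1 * x) + (v - a2 * x).
    by rewrite mulrBr mulrDl opprD -mulrA addrACA.
  by rewrite rpredD // idealMr.
pose J := HB.pack_for (idealr R) (I : R -> bool) (isIdealr.Build R I Iid).
have /pmax pJ : {subset p <= J}.
  move=> u up; rewrite -[u \in J]/(u \in I) inI; apply/asboolP.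
  by exists 0; rewrite mul0r subr0.
case/negP: xp; apply: pJ; rewrite -[x \in J]/(x \in I) inI; apply/asboolP.
by exists 1; rewrite mul1r subrr idealr0.
Qed.

End Inverse.

Definition residue_inv (x : k) : k := xget 0 [set y | y * x = 1].

Fact residue_mulVf (x : k) : x != 0 -> residue_inv x * x = 1.
Proof.
case: (residue_surj x) => r ->; rewrite residue_eq0 => rp.
have [a ha] := residue_inv_subproof rp.
have ex : exists y : k, [set y | y * residue r = 1] y.
  exists (residue a) => /=; apply/esym/eqP; rewrite -subr_eq0.
  by rewrite -rmorphM -(rmorph1 residue) -rmorphB residue_eq0.
exact: (xgetPex 0 ex).
Qed.

Fact residue_inv0 : residue_inv 0 = 0.
Proof.
rewrite /residue_inv; case: xgetP => // y _ /=.
by rewrite mulr0 => /eqP; rewrite eq_sym oner_eq0.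
Qed.

HB.instance Definition _ :=
  GRing.ComNzRing_isField.Build k residue_mulVf residue_inv0.

End ResidueField.

Section IdealPowers.
Variable A : comNzRingType.

Definition ideal_prod (I J : set A) : set A :=
  [set x | exists (n : nat) (f g : 'I_n -> A),
    [/\ forall i, I (f i), forall i, J (g i) & x = \sum_i f i * g i]].

(* [S] is the ambient ring, given as a subring of [A] *)
Definition ideal_exp (S I : set A) (n : nat) : set A :=
  iter n (ideal_prod I) S.

End IdealPowers.

(* Submodules of V over a subring S of K, given as sets. The quotient M / N is  *)
(* handled through the correspondence between its submodules and the           *)
(* submodules of V lying between N and M.                                      *)
Section Length.
Variables (K : fieldType) (V : lmodType K) (S : set K).

Definition submodule (M : set V) : Prop :=
  [/\ M 0, forall x y, M x -> M y -> M (x + y)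
     & forall a x, S a -> M x -> M (a *: x)].

Definition simple_quotient (N M : set V) : Prop :=
  [/\ N `<=` M, N <> M
    & forall X, submodule X -> N `<=` X -> X `<=` M -> X = N \/ X = M].

Definition composition_series (N M : set V) (t : nat) (c : nat -> set V) :=
  [/\ c 0%N = N, c t = M, forall i, (i <= t)%N -> submodule (c i)
    & forall i, (i < t)%N -> simple_quotient (c i) (c i.+1)].

Definition has_length (N M : set V) (t : nat) : Prop :=
  exists c, composition_series N M t c.

Definition torsion_quotient (N M : set V) : Prop :=
  forall x, M x -> exists s, [/\ S s, s != 0 & N (s *: x)].

(* [M : N]_S, the order ideal of M / N, where S has maximal ideal m *)
Definition module_index (m : set K) (M N : set V) : set K :=
  if `[< M = N >] then S
  else if `[< torsion_quotient N M >]
  then [set x | exists2 t, has_length N M t & ideal_exp S m t x]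
  else [set 0].

End Length.

Section Index.
Variables (R : idomainType) (L : fieldExtType {fraction R}).

Definition embed : R -> L := in_alg L \o @tofrac R.

Definition integral_closure : set L := [set x | integralOver embed x].

Variable p : prime_idealr R.

Definition loc_ring : set {fraction R} :=
  [set x | exists a s : R, s \notin p /\ x = tofrac a / tofrac s].

Definition loc_maxideal : set {fraction R} :=
  [set x | exists a s : R, [/\ a \in p, s \notin p & x = tofrac a / tofrac s]].

(* O_L (x) R_p, identified with its image in L (O_L is R-torsion-free) *)
Definition loc_integral_closure : set L :=
  [set x | exists (y : L) (s : R),
    [/\ integral_closure y, s \notin p & x = (tofrac s)^-1 *: y]].

Definition loc_adjoin (alpha : L) : set L :=
  [set x | exists2 q : {poly {fraction R}},
    forall i, loc_ring q`_i & x = (map_poly (in_alg L) q).[alpha]].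

(* nu_p(Ind_R(P)), for P the minimal polynomial of alpha: the exponent t with  *)
(* [O_L (x) R_p : R_p[alpha]] = (p R_p)^t; such a t exists and is unique when  *)
(* R is Dedekind, L is separable over its quotient field and alpha is an       *)
(* integral generator of L.                                                    *)
Definition val_index (alpha : L) : nat :=
  xget 0%N [set t | module_index loc_ring loc_maxideal
                      loc_integral_closure (loc_adjoin alpha)
                    = ideal_exp loc_ring loc_maxideal t].

End Index.

Arguments embed {R} L.
Arguments integral_closure {R} L.

(* Main.v *)
(** Write S = R_p. A nonzero ideal of the form {x : x b in S}, b not in S, that is
    maximal among such ideals is prime, hence equals p; together with integral
    closedness this makes p S principal, generated by any element of p outside p^2.

    Finite length of O_L,p / S[alpha]. With lambda the coordinate form of
    alpha^(n-1), the quotients b_j of P by X^(j+1) satisfy sum b_j X^j = P' and are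
    dual to the powers of alpha, so Tr(y) = lambda(P'(alpha) y) and the j-th coordinate
    of P'(alpha) y is Tr(b_j(alpha) y). Traces of integral elements lie in S: if
    f(A) = 0 with f monic over S, then the characteristic polynomial of A divides a
    power of f, and Gauss's lemma applies. Hence P'(alpha) O_L is contained in
    S[alpha], and some a^e maps O_L,p into S[alpha].

    Lower bound. Put H = prod P_i^(s_i), W = prod P_i^(l_i - 2 s_i) and
    beta = (H W)(alpha) / a. Modulo p the polynomial H divides T, say T = H U + a V,
    and P(alpha) = 0 gives beta^2 + U(alpha) beta + (W V)(alpha) = 0, so beta is
    integral. The modules S[alpha] + S beta + ... + S alpha^(j-1) beta, for j at most
    deg H, form a strictly increasing chain, because a monic polynomial of degree less
    than n divided by a does not have coefficients in S. *)

Require Import Defs.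
From HB Require Import structures.
From mathcomp Require Import all_boot all_order all_algebra all_field.
From mathcomp Require Import ring_quotient generic_quotient fraction ring.
From mathcomp Require Import boolp classical_sets.

Set Implicit Arguments.
Unset Strict Implicit.
Unset Printing Implicit Defensive.

Import GRing.Theory.

Local Open Scope ring_scope.

(** * Chains of submodules and composition series *)

Section Length.
Variables (K : fieldType) (V : lmodType K) (S : set K).
Hypothesis SN1 : S (-1).
Implicit Types (M N X : set V) (c : nat -> set V).
Local Open Scope classical_set_scope.

Lemma submoduleB M x y : submodule S M -> M x -> M y -> M (x - y).
Proof. by case=> _ MD MZ Mx My; rewrite -scaleN1r; apply: MD => //; apply: MZ. Qed.

Lemma submoduleI M N : submodule S M -> submodule S N -> submodule S (M `&` N).
Proof.
case=> M0 MD MZ [N0 ND NZ]; split=> [|x y [? ?] [? ?]|b x Sb [? ?]]; split; auto.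
Qed.

Definition add_set M N : set V := [set z | exists x y, [/\ M x, N y & z = x + y]].

Lemma submodule_add M N :
  submodule S M -> submodule S N -> submodule S (add_set M N).
Proof.
case=> M0 MD MZ [N0 ND NZ]; split.
- by exists 0, 0; rewrite addr0.
- move=> _ _ [x [y [Mx Ny ->]]] [x' [y' [Mx' Ny' ->]]].
  by exists (x + x'), (y + y'); rewrite addrACA; split; auto.
- move=> b _ Sb [x [y [Mx Ny ->]]].
  by exists (b *: x), (b *: y); rewrite scalerDr; split; auto.
Qed.

Lemma sub_addl M N : submodule S N -> M `<=` add_set M N.
Proof. by case=> N0 _ _ x Mx; exists x, 0; rewrite addr0. Qed.

Lemma sub_addr M N : submodule S M -> N `<=` add_set M N.
Proof. by case=> M0 _ _ x Nx; exists 0, x; rewrite add0r. Qed.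

Lemma add_sub M N X : submodule S X -> M `<=` X -> N `<=` X -> add_set M N `<=` X.
Proof. by case=> _ XD _ sMX sNX _ [x [y [/sMX Xx /sNX Xy ->]]]; apply: XD. Qed.

Lemma simple_modular M N X : submodule S M -> submodule S N -> submodule S X ->
  simple_quotient S M N -> M `<=` X -> X `<=` N -> ~ X `<=` M -> X = N.
Proof.
move=> sM sN sX [_ _ max] MX XN nXM.
by case: (max _ sX MX XN) => // eXM; case: nXM; rewrite eXM.
Qed.

(* The number of steps of a composition series met by X is strictly increasing in X. *)
Lemma chain_le_length N M t m (X : nat -> set V) :
  has_length S N M t -> (forall i, (i <= m)%N -> submodule S (X i)) ->
  (forall i, (i < m)%N -> X i `<=` X i.+1 /\ X i.+1 <> X i) ->
  N `<=` X 0%N -> X m `<=` M -> (m <= t)%N.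
Proof.
case=> c [c0 ct csub csimple] Xsub Xlt NX XM.
pose jump Y i := ~~ `[< Y `&` c i.+1 `<=` c i >].
pose ell Y := (\sum_(i < t) jump Y i)%N.
have jump_mono Y Z i : Y `<=` Z -> (jump Y i <= jump Z i)%N.
  move=> YZ; rewrite /jump.
  case: asboolP => //= nY; case: asboolP => //= nZ; case: nY.
  by move=> x [Yx cx]; apply: nZ; split=> //; apply: YZ.
have ell_lt Y Z : submodule S Y -> submodule S Z ->
    N `<=` Y -> Y `<=` Z -> Z `<=` M -> Z <> Y -> (ell Y < ell Z)%N.
  (* Jumps of Y are jumps of Z, so if [ell] does not grow, Y and Z jump at the same indices. This
     forces Z to lie in Y, one step of the series at a time. *)
  move=> sY sZ NY YZ ZM ZneY; rewrite ltnNge; apply/negP => leZY.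
  have jumpE i : (i < t)%N -> jump Z i = jump Y i.
    move=> it; have [_] := @leqif_sum _ xpredT
      (fun i : 'I_t => jump Y i == jump Z i :> nat) (fun i => jump Y i : nat)
      (fun i => jump Z i : nat)
      (fun i _ => leqif_eq (jump_mono Y Z i YZ)).
    have -> : (\sum_(i < t) jump Y i == \sum_(i < t) jump Z i)%N.
      by rewrite eqn_leq leZY andbT leq_sum // => j _; apply: jump_mono.
    by move=> /esym/forallP/(_ (Ordinal it)) /=; case: (jump Y i); case: (jump Z i).
  apply: ZneY; apply/seteqP; split=> // z Zz.
  have H i : (i <= t)%N -> Z `&` c i `<=` Y.
    elim: i => [|i IHi] it; first by rewrite c0 => x [_ /NY].
    move=> z1 [Zz1 cz1].
    have [cz1'|ncz1] := pselect (c i z1); first by apply: (IHi (ltnW it)).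
    have /jumpE : (i < t)%N by []. rewrite /jump.
    case: asboolP => [/(_ z1)|_]; first by case/(_ (conj Zz1 cz1))/ncz1.
    (* Y jumps at i, so simplicity gives [c i] + (Y meet [c i.+1]) = [c i.+1]. Writing z1 = u + v
       accordingly, u = z1 - v lies in Z and in [c i], hence in Y by induction. *)
    case: asboolP => //= nY _.
    have si := csub i (ltnW it); have si1 := csub i.+1 it.
    have sYc := submoduleI sY si1.
    have [cc _ _] := csimple i it.
    have : add_set (c i) (Y `&` c i.+1) z1.
      rewrite (simple_modular si si1 (submodule_add si sYc) (csimple i it)) //.
      - exact: sub_addl.
      - by apply: add_sub => // x [].
      - by move=> sub; apply: nY => x Yx; apply: sub; apply: sub_addr.
    case=> [u [v [cu [Yv cv] z1E]]].
    have Yu : Y u.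
      apply: (IHi (ltnW it)); split=> //.
      have -> : u = z1 - v by rewrite z1E addrK.
      by apply: submoduleB => //; apply: YZ.
    by rewrite z1E; case: sY => _ YD _; apply: YD.
  by apply: (H t (leqnn t)); split=> //; rewrite ct; apply: ZM.
have NX' i : (i <= m)%N -> N `<=` X i.
  elim: i => // i IHi im; apply: subset_trans (IHi (ltnW im)) _.
  by case: (Xlt i im).
have XM' i : (i <= m)%N -> X (m - i)%N `<=` M.
  elim: i => [|i IHi] im; first by rewrite subn0.
  apply: subset_trans (IHi (ltnW im)).
  have [] := Xlt (m - i.+1)%N; first by rewrite ltn_subrL; case: (m) im.
  by rewrite subnSK.
have ellX i : (i <= m)%N -> (i <= ell (X i))%N.
  elim: i => // i IHi im; apply: leq_ltn_trans (IHi (ltnW im)) _.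
  have [sX nX] := Xlt i im.
  apply: ell_lt; [exact/Xsub/ltnW|exact: Xsub|exact/NX'/ltnW|done| |done].
  by rewrite -(subKn im); apply/XM'/leq_subr.
apply: leq_trans (ellX m (leqnn m)) _.
rewrite -[leqRHS]card_ord -sum1_card; apply: leq_sum => i _.
by case: (jump _ _).
Qed.

Lemma has_length0 N : submodule S N -> has_length S N N 0.
Proof. by move=> sN; exists (fun=> N); split. Qed.

Lemma has_lengthS N M M' t : has_length S N M t -> submodule S M' ->
  simple_quotient S M M' -> has_length S N M' t.+1.
Proof.
case=> c [c0 ct csub csimple] sM' simpleM.
exists (fun i => if (i <= t)%N then c i else M'); split; rewrite ?ltnn //.
- by move=> i; case: ifP => // it _; apply: csub.
- move=> i; rewrite ltnS => it'; case: (ltngtP i t) it' => // [it|->] _; last by rewrite ct.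
  exact: csimple.
Qed.

(** Intersect the series of M' with M: each quotient of consecutive terms embeds in a simple module,
    so it is simple or zero, and repeated terms are dropped. *)
Lemma has_length_sub N M M' t : has_length S N M' t -> submodule S M ->
  N `<=` M -> M `<=` M' -> exists t', has_length S N M t'.
Proof.
case=> c [c0 ct csub csimple] sM NM MM'.
have H i : (i <= t)%N -> exists t', has_length S N (M `&` c i) t'.
  elim: i => [|i IHi] it.
    have -> : M `&` c 0%N = N by rewrite c0; apply/setIidPr.
    by exists 0%N; apply: has_length0; rewrite -c0; apply: csub.
  have [t' lt'] := IHi (ltnW it).
  have [e|ne] := pselect (M `&` c i = M `&` c i.+1); first by exists t'; rewrite -e.
  have si := csub i (ltnW it); have si1 := csub i.+1 it.
  have [cc _ max] := csimple i it.
  exists t'.+1; apply: has_lengthS lt' (submoduleI sM si1) _; split=> //.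
    by move=> x [Mx /cc].
  move=> X sX MX XM.
  (* [c i] + X is one of the two ends of the simple step. By the modular law this decides whether X
     is [M] meet [c i] or [M] meet [c i.+1]. *)
  have [] := max (add_set (c i) X); first exact: submodule_add.
  - exact: sub_addl.
  - by apply: add_sub => // x /XM[].
  - move=> e; left; apply/seteqP; split=> // x Xx; split; first by case: (XM x Xx).
    by rewrite -e; apply: sub_addr.
  - move=> e; right; apply/seteqP; split=> // x [Mx].
    rewrite -e => -[u [v [cu Xv xE]]].
    have Mu : M u.
      have -> : u = x - v by rewrite xE addrK.
      by apply: submoduleB => //; case: (XM v Xv).
    by rewrite xE; case: sX => _ XD _; apply: XD => //; apply: MX.
have [t' lt'] := H t (leqnn t); exists t'.
by move/setIidPl: MM' => MM'; move: lt'; rewrite ct MM'.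
Qed.

End Length.

(** * Ascending chains and maximal members of families of ideals *)

Section NoetherianMax.
Variable R : idomainType.
Hypothesis noethR : forall I : idealr R, finitely_generated_ideal I.

Lemma noetherian_acc (I : nat -> idealr R) :
  (forall k, {subset I k <= I k.+1}) -> exists k, {subset I k.+1 <= I k}.
Proof.
move=> Iinc.
have Ile i j : (i <= j)%N -> {subset I i <= I j}.
  elim: j => [|j IHj]; first by rewrite leqn0 => /eqP->.
  by rewrite leq_eqVlt => /predU1P[->//|/IHj ij x /ij /Iinc].
pose U : {pred R} := [pred x | `[< exists k, x \in I k >]].
have Uid : idealr_closed U.
  split.
  - by apply/asboolP; exists 0%N; apply: idealr0.
  - by apply/asboolP => -[k]; rewrite idealr1.
  move=> b u v /asboolP[i ui] /asboolP[j vj]; apply/asboolP; exists (maxn i j).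
  by rewrite rpredD ?idealMr ?(Ile _ _ _ _ ui) ?(Ile _ _ _ _ vj) ?leq_maxl ?leq_maxr.
pose J := HB.pack_for (idealr R) (U : R -> bool) (isIdealr.Build R U Uid).
have [s sE] := noethR J.
have [k sk] : exists k, forall i : 'I_(size s), s`_i \in I k.
  have h (i : 'I_(size s)) : exists k, s`_i \in I k.
    have /asboolP// : s`_i \in J.
    apply/sE; exists (fun j => (j == i)%:R).
    rewrite (bigD1 i) //= eqxx mul1r big1 ?addr0 // => j /negPf->.
    by rewrite mul0r.
  have [f fP] := choice h.
  exists (\max_i f i)%N => i; apply: Ile (fP i); exact: (leq_bigmax i).
exists k => x xk.
have /sE[c ->] : x \in J by apply/asboolP; exists k.+1.
by apply: rpred_sum => i _; apply: idealMr.
Qed.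

(** Without a maximal member, choice gives a strictly increasing sequence starting at [t0]. The
    family is indexed so that the maximal ideal comes with the datum defining it. *)
Lemma noetherian_max (T : Type) (t0 : T) (I : T -> idealr R) :
  exists t, forall t', {subset I t <= I t'} -> {subset I t' <= I t}.
Proof.
apply: contrapT => nmax.
have h t : exists t', {subset I t <= I t'} /\ ~ {subset I t' <= I t}.
  apply: contrapT => nt; apply: nmax; exists t => t' tt'.
  by apply: contrapT => n; apply: nt; exists t'.
have [f fP] := choice h.
have [k] := @noetherian_acc (fun k => I (iter k f t0)) (fun k => (fP _).1).
exact: (fP _).2.
Qed.

End NoetherianMax.

Lemma fraction_numden (R : idomainType) (x : {fraction R}) :
  exists n d, d != 0 /\ x = tofrac n / tofrac d.
Proof.
elim/quotW: x => x; exists (\n_x)%R, (\d_x)%R; split; first exact: denom_ratioP.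
apply: (@mulIf _ (tofrac (\d_x)%R)); rewrite ?tofrac_eq0 ?denom_ratioP //.
rewrite divfK ?tofrac_eq0 ?denom_ratioP //; unlock tofrac.
rewrite -[LHS]pi_mul; apply/eqmodP; rewrite /= FracField.equivfE /FracField.mulf.
by rewrite !numden_Ratio ?mulf_neq0 ?denom_ratioP ?oner_eq0 // !mulr1 mulrC.
Qed.

(** * The localization S of R at p inside the fraction field *)

Section Localization.
Variables (R : idomainType) (p : prime_idealr R).
Local Notation K := {fraction R}.
Local Notation tofrac := (@tofrac R).

Definition locp : {pred K} := fun x => `[< loc_ring p x >].

Lemma locpP x :
  reflect (exists n d, d \notin p /\ x = tofrac n / tofrac d) (x \in locp).
Proof. exact: asboolP. Qed.

Lemma loc_ringE : loc_ring p = [set` locp]%classic.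
Proof. by apply/seteqP; split=> x /locpP. Qed.

Lemma tofrac_notin d : d \notin p -> tofrac d != 0.
Proof. by rewrite tofrac_eq0; apply: contraNneq => ->; apply: idealr0. Qed.

Lemma notinM x y : x \notin p -> y \notin p -> x * y \notin p.
Proof. by rewrite prime_idealrM negb_or => -> ->. Qed.

Lemma notin1 : 1 \notin p.
Proof. by rewrite idealr1. Qed.

Lemma locp_tofrac x : tofrac x \in locp.
Proof. by apply/locpP; exists x, 1; rewrite notin1 tofrac1 divr1. Qed.

Lemma locpV d : d \notin p -> (tofrac d)^-1 \in locp.
Proof. by move=> dp; apply/locpP; exists 1, d; rewrite tofrac1 mul1r. Qed.

Fact locp_subring : subring_closed locp.
Proof.
split; first by rewrite -tofrac1 locp_tofrac.
- move=> _ _ /locpP[n [d [dp ->]]] /locpP[n' [d' [dp' ->]]].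
  apply/locpP; exists (n * d' - n' * d), (d * d'); rewrite notinM //; split=> //.
  have d0 := tofrac_notin dp; have d0' := tofrac_notin dp'.
  by rewrite -mulNr addf_div // !(tofracM, tofracB) mulNr.
- move=> _ _ /locpP[n [d [dp ->]]] /locpP[n' [d' [dp' ->]]].
  apply/locpP; exists (n * n'), (d * d'); rewrite notinM //; split=> //.
  by rewrite mulf_div !tofracM.
Qed.
HB.instance Definition _ := GRing.isSubringClosed.Build K locp locp_subring.

Lemma common_denominator n (x : 'I_n -> K) : (forall i, x i \in locp) ->
  exists s (y : 'I_n -> R), s \notin p /\ forall i, tofrac (y i) = tofrac s * x i.
Proof.
elim: n x => [|n IHn] x xS.
  by exists 1, (fun=> 0); rewrite notin1; split=> // -[].
have [s [y [sp yE]]] := IHn (fun i => x (lift ord0 i)) (fun i => xS _).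
have /locpP[n0 [d [dp xE]]] := xS ord0.
exists (s * d), (fun i => if unlift ord0 i is Some j then y j * d else s * n0).
split=> [|i]; first exact: notinM.
case: unliftP => [j ->|->]; rewrite !tofracM.
  by rewrite yE mulrAC.
by rewrite xE -mulrA [_ * (_ / _)]mulrC divfK ?tofrac_notin.
Qed.

Lemma locp_poly_denominator (q : {poly K}) : q \is a polyOver locp ->
  exists s q', s \notin p /\ map_poly tofrac q' = tofrac s *: q.
Proof.
move=> /polyOverP qS.
have [s [y [sp yE]]] := @common_denominator (size q) (fun i => q`_i) (fun i => qS i).
exists s, (\poly_(i < size q) (if insub i is Some j then y j else 0)); split=> //.
apply/polyP=> i; rewrite coef_map coefZ /= coef_poly.
case: ltnP => iq; last by rewrite nth_default ?mulr0 ?rmorph0.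
by rewrite insubT yE.
Qed.

Lemma map_tofrac_over (q : {poly R}) : map_poly tofrac q \is a polyOver locp.
Proof. by apply/polyOverP => i; rewrite coef_map locp_tofrac. Qed.

End Localization.

(** * Cancellation identities in a field *)

Section FieldIdentities.
Variable F : fieldType.
Implicit Types w x y z : F.

Lemma divfMr w y z : y != 0 -> w / z = (w * y) / (z * y).
Proof. by move=> y0; rewrite -mulf_div divff ?mulr1. Qed.

Lemma mulfV_cancel x y z : x != 0 -> z^-1 * y = (x^-1 * y) * (x^-1 * z)^-1.
Proof. by move=> x0; rewrite invfM invrK mulrACA mulVf // mul1r mulrC. Qed.

Lemma eq_mulVf_div x y n d : x != 0 -> d != 0 -> x^-1 * y = n / d -> d * y = x * n.
Proof.
move=> x0 d0 e; rewrite -[n](divfK d0) -e mulrA mulrA divff // mul1r.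
exact: mulrC.
Qed.

Lemma mulf_expV_cancel e d x i : d != 0 -> x != 0 ->
  e * (x ^- i * d) * (x ^+ i / d) = e :> F.
Proof. by move=> d0 x0; rewrite -mulrA mulrACA mulVf ?expf_neq0 // divff // !mulr1. Qed.

Lemma mulf_expV_cancelS e d x i : d != 0 -> x != 0 ->
  e * (x ^- i.+1 * d) * (x ^+ i / d) = e * x^-1 :> F.
Proof.
move=> d0 x0; have -> : e * (x ^- i.+1 * d) = e * x^-1 * (x ^- i * d).
  by rewrite exprS invfM -!mulrA.
exact: mulf_expV_cancel.
Qed.

Lemma mulf_expS_cancel s x i : s != 0 -> x != 0 ->
  s^-1 * (x^-1 * (s * x ^+ i.+1)) = x ^+ i :> F.
Proof. by move=> s0 x0; rewrite exprS; field; rewrite s0 x0. Qed.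

Lemma mulf_exp2_cancel s t x i j : x != 0 ->
  x^-1 * (s * x ^+ i.+1 * (t * x ^+ j)) = s * t * x ^+ (i + j) :> F.
Proof. by move=> x0; rewrite exprS exprD; field. Qed.

End FieldIdentities.

(** Describes S as a discrete valuation ring with uniformizer a, without a valuation: elements of S
    outside aS are units, and powers of a clear every denominator. *)
Record uniformizer (K : fieldType) (S : {pred K}) (a : K) : Prop := {
  unif_mem : a \in S;
  unif_notV : a^-1 \notin S;
  unif_unit : forall x, x \in S -> a^-1 * x \notin S -> x^-1 \in S;
  unif_arch : forall x, exists i, a ^+ i * x \in S }.

(** * The localization is a discrete valuation ring *)

Section LocalizationDvr.
Variables (R : idomainType) (p : prime_idealr R).
Hypotheses (dedR : dedekind R) (p_neq0 : nonzero_ideal p).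
Local Notation K := {fraction R}.
Local Notation tofrac := (@tofrac R).
Local Notation S := (locp p).
Let pmax := dedekind_maximal dedR p_neq0.

Lemma locp_numden x d : d \notin p -> (tofrac d * x \in S) = (x \in S).
Proof.
move=> dp; apply/idP/idP => [dx|xS]; last by rewrite rpredM ?locp_tofrac.
by rewrite -(mulKf (tofrac_notin dp) x) rpredM ?locpV.
Qed.

Lemma locp_nonunit x : x \in S -> x^-1 \notin S ->
  exists n d, [/\ n \in p, d \notin p & x = tofrac n / tofrac d].
Proof.
move=> /locpP[n [d [dp ->]]]; rewrite invf_div => nS; exists n, d; split=> //.
by apply: contraNT nS => np; apply/locpP; exists d, n.
Qed.

Definition conductor (b : K) : {pred R} := fun x => tofrac x * b \in S.

Lemma in_conductor b x : (x \in conductor b) = (tofrac x * b \in S).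
Proof. by []. Qed.

Lemma conductor_ideal b : b \notin S -> idealr_closed (conductor b).
Proof.
move=> bS; split; rewrite ?in_conductor.
- by rewrite tofrac0 mul0r rpred0.
- by rewrite tofrac1 mul1r.
move=> c u v; rewrite !in_conductor => uS vS.
by rewrite tofracD tofracM mulrDl -mulrA rpredD // rpredM ?locp_tofrac.
Qed.

(** An [idealr] is proper, and the conductor of b is proper only for b outside S; the subtype makes
    this a total family, as [noetherian_max] requires. *)
Definition conductor_idealr (b : {b : K | b \notin S}) : idealr R :=
  HB.pack_for (idealr R) (conductor (sval b) : R -> bool)
    (isIdealr.Build R (conductor (sval b)) (conductor_ideal (svalP b))).

Lemma conductorE b x : (x \in conductor_idealr b) = (tofrac x * sval b \in S).
Proof. by []. Qed.

Lemma exists_conductor (c : R) : c \in p -> c != 0 ->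
  exists2 y, y \notin S & forall z, z \in p -> tofrac z * y \in S.
Proof.
move=> cp c0.
(* The element 1/c only shows that the family of conductors is nonempty. *)
have cS : (tofrac c)^-1 \notin S.
  apply/negP => /locpP[n [d [dp]]]; have c0' : tofrac c != 0 by rewrite tofrac_eq0.
  rewrite -[_^-1]mulr1 => /(eq_mulVf_div c0' (tofrac_notin dp)).
  rewrite mulr1 -tofracM => /eqP.
  by rewrite tofrac_eq => /eqP dE; move: dp; rewrite dE mulrC idealMr.
have [b bmax] := noetherian_max (dedekind_noetherian dedR)
  (exist (fun b : K => b \notin S) _ cS) conductor_idealr.
exists (sval b); first exact: (svalP b).
(* If uv is in the conductor of b and v is not, then vb is outside S and its conductor contains that
   of b and also u; maximality returns u to the conductor of b. *)
have bprime : prime_idealr_closed (conductor (sval b)).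
  move=> u v uvb; rewrite orbC; apply/orP.
  have [vb|vb] := boolP (v \in conductor (sval b)); [by left|right].
  pose b' : {b : K | b \notin S} := exist (fun b : K => b \notin S) _ vb.
  have bb' : {subset conductor_idealr b <= conductor_idealr b'}.
    by move=> x; rewrite !conductorE /= mulrCA => xb; rewrite rpredM ?locp_tofrac.
  by apply: (bmax b' bb'); rewrite conductorE /= mulrA -tofracM.
pose q := HB.pack_for (prime_idealr R) (conductor (sval b) : R -> bool)
  (isIdealr.Build R (conductor (sval b)) (conductor_ideal (svalP b)))
  (isPrimeIdealrClosed.Build R (conductor (sval b)) bprime).
have [n [d [d0 bE]]] := fraction_numden (sval b).
have qmax : maximal_ideal q.
  apply: (dedekind_maximal dedR); exists d => //.
  rewrite [_ \in _]conductorE bE mulrC divfK ?locp_tofrac //.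
  by rewrite tofrac_eq0.
(* Elements outside p are units of S, so the conductor lies in p; being a maximal ideal, it also
   contains p. *)
move=> z zp; rewrite -conductorE; apply: (qmax p) zp => x xb.
apply: contraT => xp; case/negP: (svalP b).
by rewrite -(locp_numden _ xp) -conductorE.
Qed.

(** Determinant trick: y maps pS to itself, so on generators of p it is an eigenvalue of a matrix
    C/d with C over R and d outside p. Then dy is integral over R, hence in R. *)
Lemma stable_integral (y : K) :
  (forall z, z \in p -> exists u d, [/\ u \in p, d \notin p
     & tofrac z * y = tofrac u / tofrac d]) -> y \in S.
Proof.
move=> py; have [s sE] := dedekind_noetherian dedR p.
pose n := size s.
have sp (i : 'I_n) : s`_i \in p.
  apply/sE; exists (fun j => (j == i)%:R).
  rewrite (bigD1 i) //= eqxx mul1r big1 ?addr0 // => j /negPf->.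
  by rewrite mul0r.
have ysS (i : 'I_n) : exists c : 'I_n -> K, (forall j, c j \in S) /\
    y * tofrac s`_i = \sum_j c j * tofrac s`_j.
  have [u [d [up dp e]]] := py _ (sp i); have /sE[c uE] := up.
  exists (fun j => tofrac (c j) / tofrac d); split=> [j|].
    by rewrite rpredM ?locp_tofrac ?locpV.
  rewrite mulrC e uE raddf_sum mulr_suml; apply: eq_bigr => j _.
  by rewrite /= rmorphM mulrAC.
have [c cP] := choice ysS.
have [d [C [dp CE]]] : exists d (C : 'M[R]_n), d \notin p /\
    forall i j, tofrac (C i j) = tofrac d * c i j.
  have vS k : mxvec (\matrix_(i < n, j < n) c i j) 0 k \in S.
    by case/mxvec_indexP: k => i j; rewrite mxvecE mxE; case: (cP i) => + _; apply.
  have [d [f [dp fE]]] := common_denominator vS.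
  exists d, (\matrix_(i, j) f (mxvec_index i j)); split=> // i j.
  by rewrite mxE fE mxvecE mxE.
have : eigenvalue (map_mx tofrac C)^T (tofrac d * y).
  apply/eigenvalueP; exists (\row_i tofrac s`_i).
    apply/rowP=> i; rewrite !mxE -mulrA (cP i).2 mulr_sumr.
    by apply: eq_bigr => j _; rewrite !mxE CE [LHS]mulrC mulrA.
  (* The vector of generators is nonzero because p is nonzero. *)
  have [z zp z0] := p_neq0; apply/eqP => /rowP v0; case/negP: z0.
  have /sE[e ->] := zp; apply/eqP; apply: big1 => i _.
  have := v0 i; rewrite !mxE => /eqP; rewrite tofrac_eq0 => /eqP->.
  by rewrite mulr0.
rewrite eigenvalue_root_char map_trmx -map_char_poly => rt.
have [|r rE] := dedekind_integrally_closed dedR (x := tofrac d * y).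
  by exists (char_poly C^T); first exact: char_poly_monic.
by rewrite -(locp_numden _ dp) rE locp_tofrac.
Qed.

(** Take y outside S with yp in S. Some zy with z in p is a unit of S, since otherwise yp lies in pS
    and [stable_integral] puts y in S. Then w/z = (wy)/(zy) is in S. *)
Lemma locp_principal : exists z, [/\ z \in p, z != 0 &
  forall w, w \in p -> (tofrac z)^-1 * tofrac w \in S].
Proof.
have [c cp c0] := p_neq0.
have [y yS py] := exists_conductor cp c0.
have y0 : y != 0 by apply: contraNneq yS => ->; apply: rpred0.
have [z [zp z0 zyV]] : exists z, [/\ z \in p, z != 0 & (tofrac z * y)^-1 \in S].
  apply: contrapT => nz; case/negP: yS; apply: stable_integral => z zp.
  have [->|z0] := eqVneq z 0.
    by exists 0, 1; rewrite idealr0 notin1 tofrac0 !mul0r.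
  apply: locp_nonunit; first exact: py.
  by apply/negP => zV; apply: nz; exists z.
exists z; split=> // w wp.
have {}z0 : tofrac z != 0 by rewrite tofrac_eq0.
by rewrite mulrC (divfMr _ _ y0) rpredM ?py.
Qed.

Variable a : R.
Hypotheses (a_in : a \in p) (a_notin : ~ ideal_exp setT [set` p]%classic 2 a).

Lemma uniformizer_neq0 : a != 0.
Proof.
apply/eqP => a0; apply: a_notin; rewrite a0.
by exists 0%N, (fun=> 0), (fun=> 0); split=> [[]|[]|]; rewrite ?big_ord0.
Qed.

Lemma locp_divE x : ((tofrac a)^-1 * tofrac x \in S) = (x \in p).
Proof.
have a0 : tofrac a != 0 by rewrite tofrac_eq0 uniformizer_neq0.
apply/idP/idP => [/locpP[n [d [dp]]]|xp].
  move/(eq_mulVf_div a0 (tofrac_notin dp)).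
  rewrite -!tofracM => /eqP; rewrite tofrac_eq => /eqP dxE.
  have : d * x \in p by rewrite dxE mulrC idealMr.
  by rewrite prime_idealrM (negPf dp).
have [z [zp z0 pz]] := locp_principal.
have tz0 : tofrac z != 0 by rewrite tofrac_eq0.
(* The quotient a/z is a unit: otherwise a/z = n/d with n in p and d outside p, which puts a in the
   square of p. *)
have uV : ((tofrac z)^-1 * tofrac a)^-1 \in S.
  apply: contraT => /(locp_nonunit (pz _ a_in))[n [d [np dp]]].
  move/(eq_mulVf_div tz0 (tofrac_notin dp)).
  rewrite -!tofracM => /eqP; rewrite tofrac_eq => /eqP daE.
  have [c cd] := residue_inv_subproof pmax dp.
  (* With c inverse to d modulo p and da = zn, one has a = (cz) n + (1 - cd) a, a sum of two
     products of elements of p. *)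
  case: a_notin; exists 2%N, (fun i => if val i == 0%N then c * z else 1 - c * d),
    (fun i => if val i == 0%N then n else a); split.
  - by case=> [[|[]]] //= _; rewrite idealMr.
  - have h u : u \in p -> ideal_prod [set` p]%classic setT u.
      move=> up; exists 1%N, (fun=> u), (fun=> 1).
      by split=> //; rewrite big_ord1 mulr1.
    by case=> [[|[]]] //= _; apply: h.
  - by rewrite !big_ord_recl big_ord0 /= addr0 -mulrA -daE; ring.
by rewrite (mulfV_cancel _ _ tz0) rpredM ?pz.
Qed.

Lemma locp_uniformizer : uniformizer S (tofrac a).
Proof.
have a0 : tofrac a != 0 by rewrite tofrac_eq0 uniformizer_neq0.
have aV : (tofrac a)^-1 \notin S.
  by rewrite -[_^-1]mulr1 -tofrac1 locp_divE idealr1.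
have aunit x : x \in S -> (tofrac a)^-1 * x \notin S -> x^-1 \in S.
  move=> xS; apply: contraNT => xV.
  have [n [d [np dp ->]]] := locp_nonunit xS xV.
  by rewrite mulrA rpredM ?locpV // locp_divE.
split=> // [|x]; first exact: locp_tofrac.
have [n [d [d0 ->]]] := fraction_numden x.
suff [i iS] : exists i, tofrac a ^+ i / tofrac d \in S.
  by exists i; rewrite mulrCA rpredM ?locp_tofrac.
have {}d0 : tofrac d != 0 by rewrite tofrac_eq0.
(* If no a^i / d is in S, then every d / a^k is. The conductors of a^k / d increase with k, hence
   stabilize at some k. But d / a^(k+1) = m/e with e outside p, and m lies in the conductor at k+1
   and not at k, since 1/a is not in S. *)
apply: contrapT => nS.
have nS' i : tofrac a ^+ i / tofrac d \notin S by apply/negP=> iS; apply: nS; exists i.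
have dS k : tofrac a ^- k * tofrac d \in S.
  elim: k => [|k IHk]; first by rewrite invr1 mul1r locp_tofrac.
  apply: contraT; rewrite exprS invfM -mulrA => /(aunit _ IHk).
  by rewrite invfM invrK (negPf (nS' k)).
have [k kmax] := noetherian_max (dedekind_noetherian dedR) 0%N
  (fun i => conductor_idealr (exist (fun b : K => b \notin S) _ (nS' i))).
have /locpP[m [e [ep mE]]] := dS k.+1.
have {}mE : tofrac m = tofrac e * (tofrac a ^- k.+1 * tofrac d).
  by rewrite mE mulrC divfK // (tofrac_notin ep).
have kk u : u \in conductor_idealr (exist (fun b : K => b \notin S) _ (nS' k)) ->
    u \in conductor_idealr (exist (fun b : K => b \notin S) _ (nS' k.+1)).
  rewrite !conductorE /= => uS.
  by rewrite exprS -mulrA mulrCA rpredM ?locp_tofrac.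
have := kmax k.+1 kk m; rewrite !conductorE /=.
rewrite mE mulf_expV_cancel // mulf_expV_cancelS //.
by rewrite locp_tofrac locp_numden // (negPf aV) => /(_ isT).
Qed.

End LocalizationDvr.

(** * Powers of a uniformizer as common denominators *)

Section Uniformizer.
Variables (K : fieldType) (S : subringClosed K) (a : K).
Hypothesis aU : uniformizer S a.

Lemma unif_neq0 : a != 0.
Proof. by apply: contraNneq (unif_notV aU) => ->; rewrite invr0 rpred0. Qed.

Lemma unif_exp i : a ^+ i \in S.
Proof. by rewrite rpredX ?(unif_mem aU). Qed.

Lemma unif_poly (q : {poly K}) : exists i, a ^+ i *: q \is a polyOver S.
Proof.
elim/poly_ind: q => [|q c [i iS]]; first by exists 0%N; rewrite scaler0 rpred0.
have [j jS] := unif_arch aU c.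
exists (j + i)%N; rewrite scalerDr rpredD //.
  by rewrite exprD -scalerA scalerAl polyOverZ ?unif_exp // rpredM ?polyOverX.
by rewrite -mul_polyC -polyCM polyOverC addnC exprD -mulrA rpredM ?unif_exp.
Qed.

End Uniformizer.

(** * Characteristic polynomials and annihilating polynomials *)

Section CharPoly.
Variables (F : fieldType) (n : nat) (A : 'M[F]_n.+1).

(* [X - A] divides [f(X) - f(A)] in the ring of matrices over [F[X]]. *)
Lemma char_poly_dvd_exp f : horner_mx A f = 0 -> char_poly A %| f ^+ n.+1.
Proof.
move=> fA0; pose H g := map_mx (@polyC F) (horner_mx A g).
have [B BE] : exists B, f%:M - H f = char_poly_mx A *m B.
  elim/poly_ind: f {fA0} => [|f c [B BE]].
    by exists 0; rewrite /H !rmorph0 mulmx0 subr0.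
  (* fX + c - (f(A)A + c) = (f - f(A))X + f(A)(X - A), and f(A) commutes with X - A. *)
  exists (B *m 'X%:M + H f).
  have HS : H (f * 'X + c%:P) = H f *m map_mx (@polyC F) A + c%:P%:M.
    by rewrite /H rmorphD rmorphM /= horner_mx_X horner_mx_C map_mxD map_mxM map_scalar_mx.
  have HC : char_poly_mx A *m H f = H f *m char_poly_mx A.
    rewrite /char_poly_mx mulmxBl mulmxBr scalar_mxC -!map_mxM; congr (_ - map_mx _ _).
    exact/comm_mx_horner/comm_mx_refl.
  rewrite mulmxDr mulmxA -BE HC HS raddfD /= scalar_mxM mulmxBl /char_poly_mx mulmxBr.
  by rewrite opprD addrACA subrr addr0 addrA subrK.
(* As f(A) = 0, the scalar matrix f is (X - A)B; taking determinants gives the power of f. *)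
apply/dvdpP; exists (\det B); rewrite mulrC -det_mulmx -BE /H fA0 map_mx0 subr0.
by rewrite det_scalar.
Qed.

End CharPoly.

(** * Gauss's lemma over S and integrality of traces *)

Section GaussLemma.
Variables (R : idomainType) (p : prime_idealr R).
Hypotheses (dedR : dedekind R) (p_neq0 : nonzero_ideal p).
Variable a : R.
Hypotheses (a_in : a \in p) (a_notin : ~ ideal_exp setT [set` p]%classic 2 a).
Local Notation K := {fraction R}.
Local Notation tofrac := (@tofrac R).
Local Notation S := (locp p).
Local Notation bar := (map_poly (residue (dedekind_maximal dedR p_neq0))).
Let aU := locp_uniformizer dedR p_neq0 a_in a_notin.

Lemma bar_eq0P (q : {poly R}) : reflect (forall i, q`_i \in p) (bar q == 0).
Proof.
apply: (iffP eqP) => [q0 i|qp].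
  by rewrite -(residue_eq0 (dedekind_maximal dedR p_neq0)) -coef_map q0 coef0.
by apply/polyP=> i; rewrite coef0 coef_map; apply/eqP; rewrite residue_eq0.
Qed.

Lemma bar_eq0E (q : {poly R}) :
  (bar q == 0) = ((tofrac a)^-1 *: map_poly tofrac q \is a polyOver S).
Proof.
apply/bar_eq0P/polyOverP => h i; have := h i.
  by rewrite coefZ coef_map locp_divE.
by rewrite coefZ coef_map locp_divE.
Qed.

(** Use the least power of a that clears the coefficients of g: were the reduction zero, one factor
    a could be removed. The factor s clears the remaining denominators, prime to p. *)
Lemma primitive_multiple (g : {poly K}) : g \is monic ->
  exists i s (g' : {poly R}), [/\ s \notin p, bar g' != 0 &
    map_poly tofrac g' = (tofrac s * tofrac a ^+ i) *: g].
Proof.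
move=> gm; have ex := unif_poly aU g.
case: (ex_minnP ex) => i iS imin.
have [s [g' [sp gE]]] := locp_poly_denominator iS.
rewrite scalerA in gE.
exists i, s, g'; split=> //; rewrite bar_eq0E gE scalerA; apply/negP => g'S.
have a0 := unif_neq0 aU.
have sV := locpV sp; have s0 := tofrac_notin sp.
(* For i = 0 minimality gives nothing, but the leading coefficient is s, which is outside p. *)
case: i {iS gE} imin g'S => [_|i imin].
  move=> /polyOverP /(_ (size g).-1); rewrite coefZ -lead_coefE (monicP gm).
  by rewrite expr0 !mulr1 locp_divE // (negPf sp).
move/(polyOverZ sV); rewrite scalerA.
by rewrite mulf_expS_cancel // => /imin; rewrite ltnn.
Qed.

(** The reductions of the two primitive multiples have nonzero product over the residue field. A
    positive exponent of a for g would make that product divisible by a, so g needs no power of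
    a. *)
Lemma gauss_monic (g h : {poly K}) : g \is monic -> h \is monic ->
  g * h \is a polyOver S -> g \is a polyOver S.
Proof.
move=> gm hm ghS.
have [i [s [g' [sp g0 gE]]]] := primitive_multiple gm.
have [j [t [h' [tp h0 hE]]]] := primitive_multiple hm.
have a0 := unif_neq0 aU.
case: i => [|i] in gE *.
  rewrite expr0 mulr1 in gE.
  rewrite -(scale1r g) -(mulVf (tofrac_notin sp)) -scalerA -gE.
  by rewrite polyOverZ ?locpV ?map_tofrac_over.
have := mulf_neq0 g0 h0; rewrite -rmorphM bar_eq0E rmorphM /= gE hE.
rewrite -scalerAl -scalerAr !scalerA; case/negP; apply: polyOverZ => //.
rewrite -mulrA mulf_exp2_cancel //.
by rewrite !rpredM ?locp_tofrac ?(unif_exp aU).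
Qed.

Lemma integral_trace n (A : 'M[K]_n.+1) (f : {poly R}) :
  f \is monic -> horner_mx A (map_poly tofrac f) = 0 -> \tr A \in S.
Proof.
move=> fm /char_poly_dvd_exp /dvdpP[h fE].
have hm : h \is monic.
  rewrite -(monicMr _ (char_poly_monic A)) -fE rpredX //.
  by rewrite monic_map.
have : char_poly A \is a polyOver S.
  apply: gauss_monic hm _; first exact: char_poly_monic.
  by rewrite mulrC -fE rpredX // map_tofrac_over.
move/polyOverP/(_ n.+1.-1); rewrite char_poly_trace // rpredN; apply.
Qed.

End GaussLemma.

(** * The trace of K[X]/(P) and Euler's dual basis *)

Section Euler.
Variables (F : fieldType) (n : nat) (P : {poly F}).
Hypotheses (Pm : P \is monic) (sizeP : size P = n.+2).
Implicit Types f g h : {poly F}.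

Lemma size_modP g : (size (g %% P)%R <= n.+1)%N.
Proof. by rewrite -ltnS -sizeP ltn_modp monic_neq0. Qed.

Lemma modp_sum I (r : seq I) (G : I -> {poly F}) :
  (\sum_(i <- r) G i) %% P = \sum_(i <- r) (G i %% P).
Proof. by elim/big_rec2: _ => [|i u v _ <-]; rewrite ?mod0p ?modpD. Qed.

Lemma modpXM g : ('X * g) %% P = 'X * (g %% P) - (g %% P)`_n *: P.
Proof.
rewrite {1}(divp_eq g P) mulrDr mulrA.
have -> : 'X * (g %/ P) * P + 'X * (g %% P) =
    ('X * (g %/ P) + ((g %% P)`_n)%:P) * P + ('X * (g %% P) - (g %% P)`_n *: P).
  by rewrite mulrDl -addrA mul_polyC [_ *: P + _]addrC subrK.
rewrite modp_addl_mul_small // sizeP ltnS; apply/leq_sizeP => j.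
rewrite leq_eqVlt => /predU1P[<-|jn]; rewrite coefB coefXM coefZ.
  by rewrite -[n.+1]/(n.+2.-1) -sizeP -lead_coefE (monicP Pm) mulr1 sizeP /= subrr.
rewrite (nth_default _ (_ : size P <= j)%N) ?sizeP // mulr0 subr0.
by case: j jn => //= j jn; rewrite nth_default // (leq_trans (size_modP g)).
Qed.

Lemma coef_modpXMS g j :
  (('X * g) %% P)`_j.+1 = (g %% P)`_j - (g %% P)`_n * P`_j.+1.
Proof. by rewrite modpXM coefB coefXM coefZ. Qed.

Lemma drop_polyS j : drop_poly j P = 'X * drop_poly j.+1 P + (P`_j)%:P.
Proof.
apply/polyP => i; rewrite coefD coefXM coefC !coef_drop_poly.
by case: i => [|i] /=; rewrite ?add0r ?addr0 // addSnnS.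
Qed.

(* The drop_poly j.+1 P are dual to the X^j for the form (g, h) |-> (g h %% P)`_n. *)
Lemma coef_dual j g : (j <= n)%N ->
  (g %% P)`_j = ((drop_poly j.+1 P * g) %% P)`_n.
Proof.
(* Induction on n - j; at j = n the dual polynomial is 1 because P is monic of degree n+1. *)
move=> /subnKC; move: (n - j)%N => k; elim: k => [|k IHk] in j g *.
  rewrite addn0 => ->; have -> : drop_poly n.+1 P = 1.
    apply/polyP=> i; rewrite coef_drop_poly coef1; case: i => [|i].
      by rewrite add0n -[n.+1]/(n.+2.-1) -sizeP -lead_coefE (monicP Pm).
    by rewrite nth_default // sizeP addSn ltnS leq_addl.
  by rewrite mul1r.
(* Horner's recursion for [drop_poly] and the induction hypothesis for Xg at j+1; the two terms in
   the coefficient j+1 of P cancel. *)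
rewrite addnS -addSn => jk; rewrite drop_polyS mulrDl modpD coefD -mulrA mulrCA -IHk //.
by rewrite coef_modpXMS mul_polyC modpZl coefZ [_ * P`_ _]mulrC subrK.
Qed.

Lemma deriv_dual : P^`() = \sum_(j < n.+1) drop_poly j.+1 P * 'X^j.
Proof.
apply/polyP=> i; rewrite coef_deriv coef_sum.
have [ni|ni] := leqP n.+1 i.
  rewrite nth_default ?mul0rn ?sizeP // big1 // => j _.
  rewrite coefMXn; case: ifP => // /negbT; rewrite -leqNgt => ji.
  by rewrite coef_drop_poly nth_default // sizeP addnS subnK.
rewrite (eq_bigr (fun j : 'I_n.+1 => if (j < i.+1)%N then P`_i.+1 else 0)).
  by rewrite -big_mkcond -(big_ord_widen n.+1 (fun=> P`_i.+1) ni) sumr_const card_ord.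
move=> j _; rewrite coefMXn ltnS ltnNge; case: leqP => //= ji.
by rewrite coef_drop_poly addnS subnK.
Qed.

(** Multiplication by g on F[X]/(P) in the basis of powers of X, acting on row vectors. *)
Definition mult_mx g : 'M[F]_n.+1 := \matrix_(i, j) ((g * 'X^i) %% P)`_j.

Lemma mult_mxD g h : mult_mx (g + h) = mult_mx g + mult_mx h.
Proof. by apply/matrixP=> i j; rewrite !mxE mulrDl modpD coefD. Qed.

Lemma mult_mxC c : mult_mx c%:P = c%:M.
Proof.
apply/matrixP=> i j; rewrite !mxE mul_polyC modpZl coefZ modp_small.
  by rewrite coefXn eq_sym mulr_natr.
by rewrite size_polyXn sizeP ltnS.
Qed.

Lemma mult_mxM g h : mult_mx (g * h) = mult_mx g *m mult_mx h.
Proof.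
apply/matrixP=> i j; rewrite !mxE.
have -> : (g * h * 'X^i) %% P = (h * ((g * 'X^i) %% P)) %% P.
  by rewrite modp_mul mulrA [h * g]mulrC.
set r := (g * 'X^i) %% P.
have {1}-> : r = \sum_(k < n.+1) r`_k *: 'X^k.
  rewrite -poly_def; apply/polyP=> k; rewrite coef_poly; case: ltnP => // nk.
  by rewrite nth_default // (leq_trans (size_modP _)).
rewrite mulr_sumr modp_sum coef_sum; apply: eq_bigr => k _.
by rewrite -scalerAr modpZl coefZ !mxE.
Qed.

Lemma horner_mult_mx f g : horner_mx (mult_mx g) f = mult_mx (f \Po g).
Proof.
elim/poly_ind: f => [|f c IHf].
  by rewrite rmorph0 comp_poly0 -polyC0 mult_mxC raddf0.
rewrite rmorphD rmorphM /= horner_mx_X horner_mx_C IHf.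
by rewrite comp_polyD comp_polyM comp_polyX comp_polyC mult_mxD mult_mxM mult_mxC.
Qed.

Lemma mult_mx_dvd g : P %| g -> mult_mx g = 0.
Proof.
move=> Pg; apply/matrixP=> i j; rewrite !mxE.
by have /modp_eq0P -> := dvdp_mulr 'X^i Pg; rewrite coef0.
Qed.

(** Euler's trace formula: duality turns each diagonal entry into a top coordinate, and [deriv_dual]
    sums them. *)
Lemma trace_mult_mx g : \tr (mult_mx g) = ((P^`() * g) %% P)`_n.
Proof.
rewrite deriv_dual mulr_suml modp_sum coef_sum; apply: eq_bigr => j _.
by rewrite mxE coef_dual; [rewrite [g * _]mulrC mulrA | rewrite -ltnS].
Qed.

Lemma coef_deriv_mult g j : (j <= n)%N ->
  ((P^`() * g) %% P)`_j = \tr (mult_mx (drop_poly j.+1 P * g)).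
Proof. by move=> jn; rewrite coef_dual // trace_mult_mx mulrCA. Qed.

Lemma modp_polyOver (S : subringClosed F) g :
  P \is a polyOver S -> g \is a polyOver S -> g %% P \is a polyOver S.
Proof.
move=> /polyOverP PS; elim/poly_ind: g => [|g c IHg] gS; first by rewrite mod0p.
have cS : c \in S.
  by move/polyOverP/(_ 0%N): gS; rewrite coefD coefMX coefC add0r.
have PgS : g %% P \is a polyOver S.
  apply: IHg; apply/polyOverP => i; move/polyOverP/(_ i.+1): gS.
  by rewrite coefD coefMX coefC addr0.
rewrite modpD [c%:P %% P]modp_small ?size_polyC ?sizeP; last by case: (c != 0).
rewrite rpredD ?polyOverC // mulrC modpXM rpredB //.
  by rewrite rpredM ?polyOverX.
by apply: polyOverZ; [apply: (polyOverP PgS) | apply/polyOverP].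
Qed.

End Euler.

(** * Lattices over a discrete valuation ring and their lengths *)

Section Lattices.
Variables (K : fieldType) (S : subringClosed K) (a : K).
Hypothesis aU : uniformizer S a.
Local Notation Sset := [set` S]%classic.
Let a0 := unif_neq0 aU.

Lemma ideal_exp_unif (m : set K) t : m = [set x | a^-1 * x \in S]%classic ->
  ideal_exp Sset m t = [set x | a ^- t * x \in S]%classic.
Proof.
move=> mE; rewrite /ideal_exp; elim: t => [|t IHt] /=.
  by apply/seteqP; split=> x /=; rewrite invr1 mul1r.
rewrite IHt mE; apply/seteqP; split=> x /=.
  case=> k [f [g [fS gS ->]]]; rewrite mulr_sumr rpred_sum // => i _.
  by rewrite exprS invfM mulrACA rpredM ?fS ?gS.
move=> xS; exists 1%N, (fun=> a), (fun=> a^-1 * x); split=> [_|_|] /=.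
- by rewrite mulVf // rpred1.
- by rewrite mulrA -invfM -exprSr.
- by rewrite big_ord1 mulVKf.
Qed.

Lemma unif_exp_le i j : a ^- i * a ^+ j \in S -> (i <= j)%N.
Proof.
apply: contraTleq => ji; apply: contra (unif_notV aU) => h.
have -> : a^-1 = a ^+ (i - j.+1) * (a ^- i * a ^+ j).
  by rewrite -{2}(subnK ji) addnS exprS exprD; field; rewrite a0 !expf_neq0.
by rewrite rpredM ?(unif_exp aU).
Qed.

Variables (V : lmodType K) (n : nat) (b : 'I_n -> V).
Hypothesis b_free : forall c : 'I_n -> K,
  \sum_i c i *: b i = 0 -> forall i, c i = 0.

(** The sum of the S a^(- f i) b_i: the span of the b_i for f = 0, larger when f grows. *)
Definition lattice (f : 'I_n -> nat) : set V :=
  [set x | exists2 c, forall i, a ^+ f i * c i \in S & x = \sum_i c i *: b i]%classic.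

Lemma submodule_lattice f : submodule Sset (lattice f).
Proof.
split=> [|_ _ [c cS ->] [d dS ->]|s _ sS [c cS ->]].
- by exists (fun=> 0) => [i|]; rewrite ?mulr0 ?rpred0 // big1 // => i _; rewrite scale0r.
- exists (fun i => c i + d i) => [i|]; first by rewrite mulrDr rpredD.
  by rewrite -big_split; apply: eq_bigr => i _; rewrite scalerDl.
- exists (fun i => s * c i) => [i|]; first by rewrite mulrCA rpredM.
  by rewrite scaler_sumr; apply: eq_bigr => i _; rewrite scalerA.
Qed.

Lemma lattice_simple f k :
  simple_quotient Sset (lattice f) (lattice (fun i => f i + (i == k))%N).
Proof.
have sub : (lattice f `<=` lattice (fun i => f i + (i == k))%N)%classic.
  move=> _ [c cS ->]; exists c => // i.
  by rewrite addnC exprD -mulrA rpredM ?(unif_exp aU).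
split=> // [e|X [X0 XD XZ] fX Xf'].
  (* Strictness: by freeness the k-th coordinate of a^(- f k - 1) b_k is determined, and it is not
     allowed in [lattice f]. *)
  have : lattice (fun i => f i + (i == k))%N (a ^- (f k).+1 *: b k).
    exists (fun i => if i == k then a ^- (f k).+1 else 0) => [i|].
      case: eqP => [->|_]; last by rewrite mulr0 rpred0.
      by rewrite addn1 divff ?expf_neq0 ?rpred1.
    rewrite (bigD1 k) //= eqxx big1 ?addr0 // => i /negPf->; exact: scale0r.
  rewrite -e => -[c cS cE].
  have := b_free (c := fun i => c i - if i == k then a ^- (f k).+1 else 0).
  have -> : \sum_i (c i - if i == k then a ^- (f k).+1 else 0) *: b i = 0.
    rewrite (eq_bigr (fun i => c i *: b i - (if i == k then a ^- (f k).+1 else 0) *: b i)).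
      rewrite sumrB -cE [X in _ - X](bigD1 k) //= eqxx.
      by rewrite big1 ?addr0 ?subrr // => i /negPf->; exact: scale0r.
    by move=> i _; rewrite scalerBl.
  move=> /(_ erefl k)/eqP; rewrite eqxx subr_eq0 => /eqP ckE.
  by move: (cS k); rewrite ckE mulrC => /unif_exp_le; rewrite ltnn.
have [Xf|nXf] := pselect (X `<=` lattice f)%classic; first by left; apply/seteqP.
right; apply/seteqP; split=> // _ [d dS ->].
(* An element y of X outside [lattice f] has k-th coordinate c_k = u / a^(f k + 1) with u a unit of
   S. Subtracting (d_k / c_k) y brings any element of the larger lattice into [lattice f], so X is
   everything. *)
have [y Xy nfy] : exists2 y, X y & ~ lattice f y.
  by apply: contrapT => h; apply: nXf => y Xy; apply: contrapT => nf; apply: h; exists y.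
have [c cS yE] := Xf' y Xy.
have ckS : a ^+ f k * c k \notin S.
  apply/negP => ckS; apply: nfy; exists c => // i.
  by have := cS i; case: eqP => [->|_]; rewrite ?addn0.
pose u := a ^+ (f k).+1 * c k.
have uS : u \in S by have := cS k; rewrite eqxx addn1.
have uV : u^-1 \in S.
  by apply: (unif_unit aU uS); rewrite /u exprS -mulrA mulKf.
have ck0 : c k != 0 by apply: contraNneq ckS => ->; rewrite mulr0 rpred0.
have rS : d k / c k \in S.
  have -> : d k / c k = a ^+ (f k).+1 * d k * u^-1.
    by rewrite /u; field; rewrite expf_neq0 ?ck0.
  by rewrite rpredM // -addn1; have := dS k; rewrite eqxx.
rewrite -[\sum_i _](subrK ((d k / c k) *: y)).
apply: XD; last exact: XZ.
apply: fX; exists (fun i => d i - d k / c k * c i) => [i|].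
  have := cS i; have := dS i; case: eqP => [->|_] di ci.
    by rewrite divfK // subrr mulr0 rpred0.
  by rewrite addn0 in di ci; rewrite mulrBr rpredB // mulrCA rpredM.
rewrite yE scaler_sumr -sumrB; apply: eq_bigr => i _.
by rewrite scalerA -scalerBl.
Qed.

Lemma lattice_length f : exists t, has_length Sset (lattice (fun=> 0%N)) (lattice f) t.
Proof.
have [m fm] := ubnP (\sum_i f i)%N; elim: m => // m IHm in f fm *.
have [/forallP f0|/forallPn[k fk]] := boolP [forall i, f i == 0%N].
  have -> : f = fun=> 0%N by apply/funext => i; apply/eqP.
  by exists 0%N; apply: has_length0; apply: submodule_lattice.
have [g fE] : exists g, f = fun i => (g i + (i == k))%N.
  exists (fun i => f i - (i == k))%N; apply/funext=> i; case: eqP => [->|_].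
    by rewrite subnK // lt0n.
  by rewrite subn0 addn0.
rewrite {f fk}fE in fm *; have [|t tg] := IHm g.
  move: fm; rewrite big_split /= [X in (_ + X)%N](bigD1 k) //= eqxx.
  rewrite [X in (_ + (_ + X))%N]big1; last by move=> i /negPf->.
  by rewrite addn0 addn1 ltnS.
exists t.+1; apply: has_lengthS tg (submodule_lattice _) (lattice_simple _ _).
Qed.

End Lattices.

(** * Quadratic equations and integrality *)

Lemma quadratic_identity (F : fieldType) (A h w u v t : F) : A != 0 ->
  h * (h * w) + A * t = 0 -> t = h * u + A * v ->
  (A^-1 * (h * w)) ^+ 2 + u * (A^-1 * (h * w)) + w * v = 0.
Proof.
move=> A0 e tE; rewrite tE in e.
(* The left side is w / A^2 times h(hw) + At, which will be P(alpha) when the letters are the values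
   of H, W, U, V, T at alpha. *)
have -> : (A^-1 * (h * w)) ^+ 2 + u * (A^-1 * (h * w)) + w * v =
  A^-1 ^+ 2 * w * (h * (h * w) + A * (h * u + A * v)) by field.
by rewrite e mulr0.
Qed.

Lemma integral_quadratic (A : comNzRingType) (F : fieldType) (f : {rmorphism A -> F}) x u v :
  integralOver f u -> integralOver f v -> x ^+ 2 + u * x + v = 0 -> integralOver f x.
Proof.
move=> ui vi xE; pose q : {poly F} := 'X^2 + (u *: 'X + v%:P).
have qm : q \is monic.
  rewrite monicE lead_coefDl ?lead_coefXn // size_polyXn ltnS.
  rewrite (leq_trans (size_polyD _ _)) // geq_max (leq_trans (size_scale_leq _ _)) ?size_polyX //.
  by rewrite (leq_trans (size_polyC_leq1 _)).
apply: (integral_root_monic qm); first by apply/eqP; rewrite !hornerE; exact: xE.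
apply/(@integral_poly A F f) => i; rewrite /q !coefD coefXn coefZ coefX coefC.
by case: i => [|[|[|i]]] /=; rewrite ?mulr0 ?mulr1 ?add0r ?addr0 //;
  [exact: integral1|exact: integral0].
Qed.

Lemma scale_quadratic (F : fieldType) (A : comAlgType F) (c : F) (x u v : A) :
  (c *: x) ^+ 2 + (c *: u) * (c *: x) + c ^+ 2 *: v = c ^+ 2 *: (x ^+ 2 + u * x + v).
Proof. by rewrite exprZn -scalerAl -scalerAr scalerA -expr2 !scalerDr. Qed.

HB.instance Definition _ (R : idomainType) (L : fieldExtType {fraction R}) :=
  GRing.RMorphism.copy (embed L) (in_alg L \o @tofrac R).

(** * The localized integral closure as a subring of L *)

Section LocalizedIntegralClosure.
Variables (R : idomainType) (L : fieldExtType {fraction R}) (p : prime_idealr R).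
Local Notation tofrac := (@tofrac R).

Lemma embedE c : embed L c = (tofrac c)%:A.
Proof. by []. Qed.

Definition locint : {pred L} := fun x => `[< @loc_integral_closure R L p x >].

Lemma locintP x :
  reflect (exists2 s, s \notin p & integralOver (embed L) (tofrac s *: x))
          (x \in locint).
Proof.
apply: (iffP (asboolP _)) => [[y [s [yi sp ->]]]|[s sp xi]].
  by exists s; rewrite // scalerA divff ?(tofrac_notin sp) // scale1r.
by exists (tofrac s *: x), s; rewrite scalerA mulVf ?(tofrac_notin sp) // scale1r.
Qed.

Lemma locintE : @loc_integral_closure R L p = [set` locint]%classic.
Proof. by apply/seteqP; split=> x /asboolP. Qed.

Lemma integral_embedM c x :
  integralOver (embed L) x -> integralOver (embed L) (tofrac c *: x).
Proof.
by rewrite -mulr_algl -embedE => xi; apply: integral_mul => //; apply: integral_id.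
Qed.

Fact locint_subring : subring_closed locint.
Proof.
split.
- apply/locintP; exists 1; rewrite ?notin1 // tofrac1 scale1r; exact: integral1.
- move=> x y /locintP[s sp xi] /locintP[t tp yi]; apply/locintP.
  exists (s * t); first exact: notinM.
  rewrite tofracM scalerBr; apply: integral_sub.
    by rewrite mulrC -scalerA; apply: integral_embedM.
  by rewrite -scalerA; apply: integral_embedM.
- move=> x y /locintP[s sp xi] /locintP[t tp yi]; apply/locintP.
  exists (s * t); first exact: notinM.
  by rewrite tofracM -scalerA scalerAr scalerAl; apply: integral_mul.
Qed.
HB.instance Definition _ := GRing.isSubringClosed.Build L locint locint_subring.

Lemma locint_integral x : integralOver (embed L) x -> x \in locint.
Proof. by move=> xi; apply/locintP; exists 1; rewrite ?notin1 // tofrac1 scale1r. Qed.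

Lemma locint_alg c : c \in locp p -> c%:A \in locint.
Proof.
case/locpP=> m [s [sp ->]]; apply/locintP; exists s => //.
rewrite scalerA mulrC divfK ?(tofrac_notin sp) // -embedE; exact: integral_id.
Qed.

Lemma locintZ c x : c \in locp p -> x \in locint -> c *: x \in locint.
Proof. by move=> cS xM; rewrite -mulr_algl rpredM ?locint_alg. Qed.

Lemma submodule_locint : submodule (loc_ring p) [set` locint]%classic.
Proof.
split=> [|x y xM yM|c x /asboolP cS xM] /=; [exact: rpred0|exact: rpredD|].
exact: locintZ.
Qed.

Lemma locint_quadratic x u v : u \in locint -> v \in locint ->
  x ^+ 2 + u * x + v = 0 -> x \in locint.
Proof.
move=> /locintP[s sp ui] /locintP[t tp vi] xE; apply/locintP.
exists (s * t); first exact: notinM.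
(* With c = st, the element cx is a root of X^2 + (cu)X + c^2 v, whose coefficients are integral
   over R. *)
apply: (@integral_quadratic _ _ (embed L) _ (tofrac (s * t) *: u) (tofrac (s * t) ^+ 2 *: v)).
- by rewrite tofracM mulrC -scalerA; apply: integral_embedM.
- have -> : tofrac (s * t) ^+ 2 = tofrac (s * (s * t)) * tofrac t.
    by rewrite expr2 -!tofracM; congr tofrac; ring.
  by rewrite -scalerA; apply: integral_embedM.
- by rewrite scale_quadratic xE scaler0.
Qed.

End LocalizedIntegralClosure.
Arguments locint {R} L p _.

(** * The extension L as K[X]/(P), and finiteness of the length *)

Section Extension.
Variables (R : idomainType) (L : fieldExtType {fraction R}) (p : prime_idealr R).
Hypotheses (dedR : dedekind R) (p_neq0 : nonzero_ideal p).
Hypothesis sepL : separable 1%VS {: L}%VS.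
Variable alpha : L.
Hypotheses (alpha_int : integral_closure L alpha)
  (alpha_gen : <<1; alpha>>%VS = {: L}%VS).
Variable P : {poly R}.
Hypothesis minP : map_poly (embed L) P = minPoly 1%VS alpha.
Variable a : R.
Hypotheses (a_in : a \in p) (a_notin : ~ ideal_exp setT [set` p]%classic 2 a).
Local Notation K := {fraction R}.
Local Notation tofrac := (@tofrac R).
Local Notation S := (locp p).
Local Notation ev := (horner_alg alpha).
Local Notation PK := (map_poly tofrac P).
Local Notation M := (locint L p).
Let aU := locp_uniformizer dedR p_neq0 a_in a_notin.

Lemma ev_tofrac (g : {poly R}) : ev (map_poly tofrac g) = (map_poly (embed L) g).[alpha].
Proof. by rewrite [LHS]/(_.[alpha]) -map_poly_comp. Qed.

Lemma tofrac_inj : injective (tofrac : R -> K).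
Proof. by move=> x y /eqP; rewrite tofrac_eq => /eqP. Qed.

Lemma embed_inj : injective (embed L).
Proof. by move=> x y /fmorph_inj/tofrac_inj. Qed.

Lemma minpoly_monic : P \is monic.
Proof.
rewrite monicE -(inj_eq embed_inj) rmorph1 -(lead_coef_map_inj embed_inj) ?rmorph0 //.
by rewrite minP -monicE monic_minPoly.
Qed.

Lemma minpoly_monicK : PK \is monic.
Proof. by rewrite monic_map ?minpoly_monic. Qed.

Lemma size_minpolyK : size PK = (adjoin_degree 1 alpha).+1.
Proof.
rewrite -size_minPoly -minP !size_map_inj_poly ?rmorph0 ?tofrac0 //.
  exact: embed_inj.
exact: tofrac_inj.
Qed.

(** L has degree n+1 over K, so that P has size n+2 as in the trace computations. *)
Let n := (adjoin_degree 1 alpha).-1.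

Let sizePK : size PK = n.+2.
Proof. by rewrite size_minpolyK. Qed.

Lemma ev_eq0 q : (ev q == 0) = (PK %| q).
Proof.
rewrite -(dvdp_map (in_alg L)) -map_poly_comp -[map_poly (_ \o _) P]/(map_poly (embed L) P).
rewrite minP; apply/idP/idP => [q0|/dvdpP[c qE]].
  by apply: minPoly_dvdp; [apply/polyOver1P; exists q | exact: q0].
have /eqP : (map_poly (in_alg L) q).[alpha] = 0 by rewrite qE hornerM minPolyxx mulr0.
exact.
Qed.

Lemma ev_mod q : ev (q %% PK) = ev q.
Proof.
rewrite [in RHS](divp_eq q PK) rmorphD rmorphM /=.
by have /eqP -> : ev PK == 0; rewrite ?ev_eq0 // mulr0 add0r.
Qed.

Lemma ev_surj x : exists q, x = ev q.
Proof.
have xa : x \in <<1; alpha>>%VS by rewrite alpha_gen memvf.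
have /polyOver1P[q qE] := Fadjoin_polyOver 1 alpha x.
by exists q; rewrite -[LHS](Fadjoin_poly_eq xa) qE.
Qed.

Lemma ev_inj (q r : {poly K}) : (size q <= n.+1)%N -> (size r <= n.+1)%N -> ev q = ev r -> q = r.
Proof.
move=> sq sr /eqP; rewrite -subr_eq0 -rmorphB ev_eq0 => /modp_eq0P qr.
apply/eqP; rewrite -subr_eq0 -qr modp_small // sizePK ltnS.
by rewrite (leq_trans (size_polyD _ _)) // size_polyN geq_max sq sr.
Qed.

Lemma ev_comp (f : {poly R}) h :
  ev (map_poly tofrac f \Po h) = (map_poly (embed L) f).[ev h].
Proof.
elim/poly_ind: f => [|f c IHf]; first by rewrite !rmorph0 horner0.
rewrite !rmorphD !rmorphM /= !map_polyX !map_polyC /= comp_polyX comp_polyC.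
by rewrite IHf !hornerE horner_algC.
Qed.

Lemma integral_ev_tofrac (g : {poly R}) : integralOver (embed L) (ev (map_poly tofrac g)).
Proof.
rewrite ev_tofrac; apply: integral_horner => //.
by apply/integral_poly => i; rewrite coef_map; apply: integral_id.
Qed.

Lemma integral_dual (q : {poly K}) : integralOver (embed L) (ev q) ->
  (PK^`() * q) %% PK \is a polyOver S.
Proof.
move=> qi; apply/polyOverP => j.
have [jn|nj] := leqP j n; last first.
  by rewrite nth_default ?rpred0 // (leq_trans (size_modP minpoly_monicK sizePK _)).
rewrite (coef_deriv_mult minpoly_monicK sizePK) //.
set h := drop_poly j.+1 PK * q.
have [f fm froot] : integralOver (embed L) (ev h).
  rewrite rmorphM /=; apply: integral_mul => //.
  have -> : drop_poly j.+1 PK = map_poly tofrac (drop_poly j.+1 P).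
    by apply/polyP=> i; rewrite coef_map !coef_drop_poly coef_map.
  exact: integral_ev_tofrac.
apply: (integral_trace dedR p_neq0 a_in a_notin fm).
(* f kills h(alpha), so P divides f composed with h, and f kills the multiplication matrix of h. *)
rewrite (horner_mult_mx minpoly_monicK sizePK); apply: mult_mx_dvd.
by rewrite -ev_eq0 ev_comp.
Qed.

Lemma ev_deriv_neq0 : ev PK^`() != 0.
Proof.
have -> : ev PK^`() = (minPoly 1 alpha)^`().[alpha].
  by rewrite deriv_map ev_tofrac -minP deriv_map.
have /separableP/(_ alpha (memvf _)) sep := sepL.
by have := separable_root_der 1%AS alpha; rewrite sep.
Qed.

Lemma adjoinP x :
  @loc_adjoin R L p alpha x <-> exists2 q, q \is a polyOver S & x = ev q.
Proof.
split=> -[q qS ->]; exists q => //; first by apply/polyOverP => i; apply/asboolP/qS.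
by move=> i; apply/asboolP/(polyOverP qS).
Qed.

Lemma adjoin_locint q : q \is a polyOver S -> ev q \in M.
Proof.
move=> /polyOverP qS; have -> : ev q = (map_poly (in_alg L) q).[alpha] by [].
rewrite horner_coef rpred_sum // => i _.
by rewrite coef_map rpredM ?locint_alg ?rpredX ?locint_integral.
Qed.

Lemma locint_bounded : exists e, forall x, x \in M ->
  exists2 q, q \is a polyOver S & tofrac a ^+ e *: x = ev q.
Proof.
have [u uE] := ev_surj (ev PK^`())^-1; have [e eS] := unif_poly aU u.
exists e => x /locintP[s sp]; have [q ->] := ev_surj x.
move=> xi; have qS : tofrac s *: ((PK^`() * q) %% PK) \is a polyOver S.
  by rewrite -modpZl scalerAr integral_dual // linearZ /= mulr_algl.
(* u represents 1 / P'(alpha) and a^e clears its denominators; the remainder of P'q has coefficients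
   in S because s is a unit there. *)
exists (tofrac a ^+ e *: u * ((PK^`() * q) %% PK)).
  rewrite rpredM // -[_ %% _](scalerK (tofrac_notin sp)) polyOverZ //.
  exact: locpV.
rewrite -scalerAl linearZ /= rmorphM /= ev_mod rmorphM /= -uE.
by rewrite mulr_algl mulKf ?ev_deriv_neq0.
Qed.

Local Notation Mset := (@loc_integral_closure R L p).
Local Notation Nset := (@loc_adjoin R L p alpha).
Local Notation Sset := (loc_ring p).
Local Notation powers := (fun i : 'I_n.+1 => alpha ^+ i).

Lemma ev_coef (q : {poly K}) : (size q <= n.+1)%N ->
  ev q = \sum_(i < n.+1) q`_i *: alpha ^+ i.
Proof.
move=> sq; have -> : ev q = (map_poly (in_alg L) q).[alpha] by [].
rewrite (horner_coef_wide _ (_ : _ <= n.+1)%N); last first.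
  by rewrite size_map_inj_poly ?rmorph0 //; apply: fmorph_inj.
by apply: eq_bigr => i _; rewrite coef_map mulr_algl.
Qed.

Lemma powers_free (c : 'I_n.+1 -> K) : \sum_i c i *: powers i = 0 -> forall i, c i = 0.
Proof.
move=> c0 i; pose q : {poly K} := \poly_(j < n.+1) c (inord j).
have qE (j : 'I_n.+1) : q`_j = c j by rewrite coef_poly ltn_ord inord_val.
have sq : (size q <= n.+1)%N by apply: size_poly.
rewrite -qE (ev_inj (r := 0) sq) ?coef0 ?size_poly0 // rmorph0 ev_coef //.
by rewrite -[RHS]c0; apply: eq_bigr => j _; rewrite qE.
Qed.

(** P is monic over R, so reduction modulo P keeps coefficients in S and the first n+1 powers of
    alpha suffice. *)
Lemma adjoin_lattice : Nset = lattice S (tofrac a) powers (fun=> 0%N).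
Proof.
apply/seteqP; split=> x.
  move=> /adjoinP[q qS ->]; rewrite -ev_mod.
  rewrite ev_coef; last exact: (size_modP minpoly_monicK sizePK).
  exists (fun i => (q %% PK)`_i) => // i; rewrite expr0 mul1r.
  have PS : PK \is a polyOver S by apply: map_tofrac_over.
  exact/polyOverP/(modp_polyOver minpoly_monicK sizePK).
case=> c cS ->; apply/adjoinP; exists (\poly_(j < n.+1) c (inord j)).
  apply/polyOverP => i; rewrite coef_poly; case: ifP => _; last exact: rpred0.
  by rewrite -[c _]mul1r -(expr0 (tofrac a)) cS.
rewrite ev_coef ?size_poly //; apply: eq_bigr => j _.
by rewrite coef_poly ltn_ord inord_val.
Qed.

Lemma submodule_adjoin : submodule Sset Nset.
Proof. by rewrite adjoin_lattice loc_ringE; exact: submodule_lattice. Qed.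

Lemma submodule_closure : submodule Sset Mset.
Proof. by rewrite locintE; apply: submodule_locint. Qed.

Lemma adjoin_sub_closure : (Nset `<=` Mset)%classic.
Proof. by rewrite locintE => x /adjoinP[q qS ->]; apply: adjoin_locint. Qed.

(** The localized closure lies between S[alpha] and a^(-e) S[alpha], two lattices whose quotient has
    finite length. *)
Lemma closure_length : exists t, has_length Sset Nset Mset t.
Proof.
have [e eM] := locint_bounded.
have [t lt] := lattice_length aU powers_free (fun=> e).
have SN1 : Sset (-1) by rewrite loc_ringE /= rpredN rpred1.
apply: (@has_length_sub _ _ _ SN1 _ _ (lattice S (tofrac a) powers (fun=> e)) t).
- by rewrite adjoin_lattice loc_ringE.
- exact: submodule_closure.
- exact: adjoin_sub_closure.
rewrite locintE => x /= /eM[q qS qE].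
have /adjoinP : exists2 q, q \is a polyOver S & tofrac a ^+ e *: x = ev q by exists q.
rewrite adjoin_lattice => -[c cS xE].
have ae0 : tofrac a ^+ e != 0 by rewrite expf_neq0 ?(unif_neq0 aU).
exists (fun i => tofrac a ^- e * c i) => [i|].
  by rewrite mulVKf // -[c i]mul1r -(expr0 (tofrac a)) cS.
rewrite -[x](scalerK ae0) xE scaler_sumr; apply: eq_bigr => i _.
by rewrite scalerA.
Qed.

Lemma closure_torsion : torsion_quotient Sset Nset Mset.
Proof.
move=> x; rewrite locintE => /= xM; have [e /(_ x xM)[q qS qE]] := locint_bounded.
exists (tofrac a ^+ e); split.
- by rewrite loc_ringE; apply: (unif_exp aU).
- by rewrite expf_neq0 ?(unif_neq0 aU).
- by apply/adjoinP; exists q.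
Qed.

(** * A strictly increasing chain above S[alpha] built from beta = G(alpha)/a *)

Section Chain.
Variables (G : {poly R}) (h : nat).
Hypotheses (Gm : G \is monic) (sizeG : (size G + h = size P)%N).
Let sizeG' : (size G + h = n.+2)%N.
Proof. by rewrite sizeG -sizePK size_map_inj_poly ?tofrac0 //; apply: tofrac_inj. Qed.
Let beta := (tofrac a)^-1 *: ev (map_poly tofrac G).
Hypothesis beta_int : beta \in M.

(** The bound on [size c] means degree below j, so [chain 0] is S[alpha]. *)
Definition chain j : set L :=
  [set x | exists q (c : {poly K}), [/\ q \is a polyOver S, c \is a polyOver S,
     (size c <= j)%N & x = ev q + ev c * beta]]%classic.

Lemma submodule_chain j : submodule Sset (chain j).
Proof.
split.
- exists 0, 0; rewrite size_poly0 !rpred0; split=> //.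
  by rewrite rmorph0 mul0r addr0.
- move=> _ _ [q [c [qS cS cj ->]]] [r [d [rS dS dj ->]]].
  exists (q + r), (c + d); split; try exact: rpredD.
    by rewrite (leq_trans (size_polyD _ _)) // geq_max cj.
  by rewrite !rmorphD mulrDl addrACA.
- move=> s _ /asboolP sS [q [c [qS cS cj ->]]].
  exists (s *: q), (s *: c); split; try exact: polyOverZ.
    exact: leq_trans (size_scale_leq _ _) cj.
  by rewrite !linearZ /= !mulr_algl scalerDr scalerAl.
Qed.

Lemma chain_neq j : (j < h)%N -> chain j.+1 <> chain j.
Proof.
move=> jh e; have : chain j.+1 (ev 'X^j * beta).
  exists 0, 'X^j; rewrite rpred0 rpredX ?polyOverX // size_polyXn; split=> //.
  by rewrite rmorph0 add0r.
rewrite e => -[q [c [qS cS cj /eqP]]].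
rewrite -subr_eq -mulrBl -rmorphB /= => /eqP bE.
have Xm : 'X^j - c \is monic.
  by rewrite monicE lead_coefDl ?lead_coefXn // size_polyN size_polyXn ltnS.
have sX : size ('X^j - c) = j.+1.
  by rewrite size_polyDl size_polyXn // size_polyN ltnS.
have GKm : map_poly tofrac G \is monic by rewrite monic_map.
have sG : size (map_poly tofrac G) = size G.
  by rewrite size_map_inj_poly ?tofrac0 //; apply: tofrac_inj.
set r := q %% PK.
have rS : r \is a polyOver S.
  by apply: (modp_polyOver minpoly_monicK sizePK); rewrite ?map_tofrac_over.
(* As j < h, both sides have degree at most n, so equality at alpha is equality of polynomials. The
   left side is monic, hence the leading coefficient of r is 1/a, which is not in S. *)
have fE : ('X^j - c) * map_poly tofrac G = tofrac a *: r.
  apply: ev_inj.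
  - rewrite size_monicM ?monic_neq0 // sX sG addSn /= -ltnS -sizeG' addnC.
    by rewrite -addnS leq_add2l.
  - exact: leq_trans (size_scale_leq _ _) (size_modP minpoly_monicK sizePK _).
  rewrite linearZ /= ev_mod -bE rmorphM /= mulr_algl scalerAr /beta.
  by rewrite scalerA divff ?(unif_neq0 aU) // scale1r.
have /monicP : tofrac a *: r \is monic by rewrite -fE rpredM.
rewrite lead_coefZ => lE; case/negP: (unif_notV aU).
have -> : (tofrac a)^-1 = lead_coef r.
  by rewrite -[LHS]mulr1 -lE mulKf ?(unif_neq0 aU).
by apply/polyOverP.
Qed.

Lemma chain_length t : has_length Sset Nset Mset t -> (h <= t)%N.
Proof.
have SN1 : Sset (-1) by rewrite loc_ringE /= rpredN rpred1.
move=> lt; apply: (chain_le_length SN1 lt (X := chain)) => [j _|j jh| |].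
- exact: submodule_chain.
- split; last exact: chain_neq.
  by move=> x [q [c [qS cS cj ->]]]; exists q, c; split=> //; apply: leqW.
- move=> x /adjoinP[q qS ->]; exists q, 0; rewrite rpred0 size_poly0; split=> //.
  by rewrite rmorph0 mul0r addr0.
- rewrite locintE => _ [q [c [qS cS _ ->]]] /=.
  by rewrite rpredD ?rpredM ?adjoin_locint.
Qed.

End Chain.

(** * The index exponent as a length *)

Lemma loc_maxidealE : loc_maxideal p = [set x | (tofrac a)^-1 * x \in S]%classic.
Proof.
have a0 := unif_neq0 aU.
apply/seteqP; split=> x /=.
  case=> m [d [mp dp ->]]; rewrite mulrA rpredM ?locpV //.
  by rewrite (locp_divE dedR p_neq0 a_in a_notin).
case/locpP=> m [d [dp xE]]; exists (a * m), d; split=> //.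
  by rewrite mulrC idealMr.
by rewrite tofracM -mulrA -xE mulVKf.
Qed.

Lemma loc_maxideal_exp t :
  ideal_exp Sset (loc_maxideal p) t = [set x | tofrac a ^- t * x \in S]%classic.
Proof. by rewrite loc_ringE; apply: (ideal_exp_unif aU); apply: loc_maxidealE. Qed.

Lemma loc_maxideal_exp_le t u :
  ideal_exp Sset (loc_maxideal p) t = ideal_exp Sset (loc_maxideal p) u -> (t <= u)%N.
Proof.
rewrite !loc_maxideal_exp => e; apply: (unif_exp_le aU).
have : [set x | tofrac a ^- u * x \in S]%classic (tofrac a ^+ u).
  by rewrite /= mulVf ?rpred1 // expf_neq0 ?(unif_neq0 aU).
by rewrite -e.
Qed.

(** Lengths are unique by comparing two series with [chain_le_length], and powers of the maximal
    ideal determine their exponent; so the exponent chosen by [xget] is the length. *)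
Lemma val_index_length : has_length Sset Nset Mset (val_index p alpha).
Proof.
have SN1 : Sset (-1) by rewrite loc_ringE /= rpredN rpred1.
have [t1 lt1] := closure_length.
have le t t' : has_length Sset Nset Mset t -> has_length Sset Nset Mset t' -> (t <= t')%N.
  case=> c [c0 ct csub csimple] lt'.
  apply: (chain_le_length SN1 lt' csub) => [i it| |]; rewrite ?c0 ?ct //.
  by have [cc ne _] := csimple i it; split=> // e; apply: ne.
suff iE : module_index Sset (loc_maxideal p) Mset Nset = ideal_exp Sset (loc_maxideal p) t1.
  rewrite /val_index; case: xgetP => [t _ /= tE|/(_ t1)]; last by case.
  suff -> : t = t1 by [].
  by apply/eqP; rewrite eqn_leq !loc_maxideal_exp_le -?iE -?tE.
(* When the modules coincide the index is S, the zeroth power, and the length is 0. *)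
rewrite /module_index; case: asboolP => [MN|MN].
  suff -> : t1 = 0%N by [].
  apply/eqP; rewrite -leqn0; apply: le => //.
  by rewrite MN; apply: has_length0; apply: submodule_adjoin.
case: asboolP => [_|/(_ closure_torsion)//].
apply/seteqP; split=> x /=; last by exists t1.
by case=> t lt; have -> // : t = t1; apply/eqP; rewrite eqn_leq !le.
Qed.

(** The second hypothesis says that H divides T modulo p, U lifting the quotient; V is the error
    divided by a, and supplies the constant term of the quadratic equation. *)
Lemma quotient_locint (H W T U : {poly R}) :
  P = H * (H * W) + a *: T ->
  (tofrac a)^-1 *: map_poly tofrac (T - U * H) \is a polyOver S ->
  (tofrac a)^-1 *: ev (map_poly tofrac (H * W)) \in M.
Proof.
set V := (tofrac a)^-1 *: map_poly tofrac (T - _) => PE VS; have a0 := unif_neq0 aU.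
have evi (Q : {poly R}) : ev (map_poly tofrac Q) \in M.
  exact/locint_integral/integral_ev_tofrac.
apply: (@locint_quadratic _ _ _ _ (ev (map_poly tofrac U)) (ev (map_poly tofrac W) * ev V)).
- exact: evi.
- by rewrite rpredM ?evi ?adjoin_locint.
have AV : ((tofrac a)^-1)%:A = ((tofrac a)%:A)^-1 :> L := fmorphV (in_alg L) _.
rewrite -mulr_algl AV [map_poly tofrac (H * W)]rmorphM rmorphM.
have A0 : (tofrac a)%:A != 0 :> L by rewrite scaler_eq0 negb_or a0 oner_eq0.
apply: (@quadratic_identity _ _ _ _ _ _ (ev (map_poly tofrac T)) A0).
  have /eqP <- : ev PK == 0 by rewrite ev_eq0.
  rewrite PE rmorphD -mul_polyC !rmorphM /= map_polyC /=.
  by rewrite rmorphD !rmorphM /= horner_algC.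
rewrite /V linearZ /= !mulr_algl scalerA divff // scale1r rmorphB rmorphM /= rmorphB rmorphM /=.
by rewrite mulrC addrC subrK.
Qed.

End Extension.

(** * Coprime factors, degrees of monic products, and lifting from the residue field *)

Section PolyFactors.
Variable F : fieldType.
Implicit Types p q : {poly F}.

Lemma irreducible_monic_coprime p q : irreducible_poly p -> irreducible_poly q ->
  p \is monic -> q \is monic -> p != q -> coprimep p q.
Proof.
move=> [sp ip] [sq iq] pm qm; apply: contraR.
rewrite coprimep_def => gneq; have gp := ip _ gneq (dvdp_gcdl p q).
have gq := iq _ gneq (dvdp_gcdr p q).
rewrite -eqp_monic //; apply: eqp_trans gq; by rewrite eqp_sym.
Qed.

Lemma dvdp_prod_coprime (I : eqType) (r : seq I) (f : I -> {poly F}) q : uniq r ->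
  (forall i j, i != j -> coprimep (f i) (f j)) -> (forall i, f i %| q) ->
  \prod_(i <- r) f i %| q.
Proof.
move=> + fco fq; elim: r => [|i r IHr] /=; first by rewrite big_nil dvd1p.
case/andP=> ir /IHr qr; rewrite big_cons Gauss_dvdp ?fq ?qr //.
elim: r ir {IHr qr} => [|j r IHr]; first by rewrite big_nil coprimep1.
by rewrite in_cons negb_or big_cons coprimepMr => /andP[/fco-> /IHr].
Qed.

End PolyFactors.

Lemma pred_size_monicM (A : nzRingType) (p q : {poly A}) : p \is monic -> q \is monic ->
  (size (p * q)).-1 = ((size p).-1 + (size q).-1)%N.
Proof.
move=> pm qm; rewrite size_monicM ?monic_neq0 //.
have : (0 < size p)%N by rewrite size_poly_gt0 monic_neq0.
have : (0 < size q)%N by rewrite size_poly_gt0 monic_neq0.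
by case: (size p) (size q) => // x [] // y _ _; rewrite addSn addnS.
Qed.

Lemma size_prod_exp_monic (A : comNzRingType) (I : Type) (r : seq I) (f : I -> {poly A})
    (e : I -> nat) : (forall i, f i \is monic) ->
  (\sum_(i <- r) e i * (size (f i)).-1)%N = (size (\prod_(i <- r) f i ^+ e i)).-1.
Proof.
move=> fm; elim: r => [|i r IHr]; first by rewrite !big_nil size_poly1.
rewrite !big_cons IHr pred_size_monicM ?rpredX //; last first.
  by apply: rpred_prod => j _; apply: rpredX.
congr addn; elim: (e i) => [|m IHm]; first by rewrite expr0 size_poly1.
by rewrite exprS pred_size_monicM ?rpredX // mulSn IHm.
Qed.

Lemma size_map_monic (A B : nzRingType) (f : {rmorphism A -> B}) (q : {poly A}) :
  q \is monic -> size (map_poly f q) = size q.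
Proof. by move=> qm; rewrite size_map_poly_id0 // (monicP qm) rmorph1 oner_eq0. Qed.

Lemma residue_poly_surj (R : idomainType) (p : prime_idealr R) (pmax : maximal_ideal p)
  (q : {poly residue_field pmax}) : exists q', q = map_poly (residue pmax) q'.
Proof.
have [f fE] := choice (fun x : residue_field pmax => residue_surj x).
exists (\poly_(i < size q) f q`_i); apply/polyP=> i; rewrite coef_map coef_poly.
by case: ltnP => iq; [apply: fE | rewrite nth_default // raddf0].
Qed.

(** * The lower bound from the factorization modulo p *)

Theorem theorem1p1 (R : idomainType) (dedR : dedekind R)
  (L : fieldExtType {fraction R}) (sepL : separable 1%VS {: L}%VS)
  (alpha : L) (alpha_int : integral_closure L alpha)
  (alpha_gen : <<1; alpha>>%VS = {: L}%VS)
  (P : {poly R}) (minP : map_poly (embed L) P = minPoly 1%VS alpha)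
  (p : prime_idealr R) (p_neq0 : nonzero_ideal p)
  (r : nat) (Pi : 'I_r -> {poly R}) (l : 'I_r -> nat)
  (bar := map_poly (residue (dedekind_maximal dedR p_neq0)))
  (Pi_monic : forall i, Pi i \is monic)
  (Pi_irr : forall i, irreducible_poly (bar (Pi i)))
  (Pi_distinct : injective (fun i => bar (Pi i)))
  (l_gt0 : forall i, (0 < l i)%N)
  (P_fact : bar P = \prod_(i < r) bar (Pi i) ^+ l i)
  (T : {poly R}) (T_neq0 : bar T != 0)
  (a : R) (a_in : a \in p)
  (a_notin : ~ ideal_exp setT [set` p]%classic 2 a)
  (P_eq : P = \prod_(i < r) Pi i ^+ l i + a *: T)
  (t : 'I_r -> nat)
  (t_dvd : forall i, bar (Pi i) ^+ t i %| bar T)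
  (t_max : forall i m, bar (Pi i) ^+ m %| bar T -> (m <= t i)%N)
  (s := fun i => minn (l i)./2 (t i)) :
  (\sum_(i < r) s i * (size (Pi i)).-1 <= val_index p alpha)%N /\
  (\sum_(i < r) s i * (size (Pi i)).-1)%N
    = (size (\prod_(i < r) Pi i ^+ s i)).-1.
Proof.
have degH := size_prod_exp_monic (index_enum 'I_r) s Pi_monic.
split=> //; rewrite degH.
set H : {poly R} := \prod_(i < r) Pi i ^+ s i.
(* The exponents involve no truncation because s_i is at most half of l_i; hence H^2 W is the
   product of the P_i^(l_i). *)
pose W : {poly R} := \prod_(i < r) Pi i ^+ (l i - (s i).*2).
have s_le i : ((s i).*2 <= l i)%N.
  by rewrite -geq_half_double geq_minl.
have HHW : H * (H * W) = \prod_(i < r) Pi i ^+ l i.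
  rewrite /H /W -!big_split; apply: eq_bigr => i _ /=.
  by rewrite -!exprD addnA addnn subnKC.
have prod_monic (e : 'I_r -> nat) : \prod_(i < r) Pi i ^+ e i \is monic.
  by apply: rpred_prod => i _; apply: rpredX.
have HWm : H * W \is monic by rewrite rpredM ?prod_monic.
have Pm : P \is monic := minpoly_monic minP.
have bar_prod (e : 'I_r -> nat) :
    bar (\prod_(i < r) Pi i ^+ e i) = \prod_(i < r) bar (Pi i) ^+ e i.
  by rewrite /bar rmorph_prod; apply: eq_bigr => i _; rewrite rmorphXn.
(* The degree of P is read modulo p, where P becomes the reduction of H^2 W; monic polynomials keep
   their degree. *)
have sizeHW : (size (H * W)%R + (size H).-1 = size P)%N.
  rewrite -(size_map_monic (residue (dedekind_maximal dedR p_neq0)) Pm) -/bar P_fact.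
  rewrite -bar_prod -HHW size_map_monic ?rpredM ?prod_monic // [RHS]size_monicM ?prod_monic ?monic_neq0 //.
  have : (0 < size H)%N by rewrite size_poly_gt0 monic_neq0 ?prod_monic.
  by case: (size H) => // h _; rewrite addSn /= addnC.
(* Each P_i^(s_i) divides T modulo p because s_i is at most t_i, and powers of distinct monic
   irreducibles are coprime. *)
have /dvdpP[u uE] : bar H %| bar T.
  rewrite bar_prod; apply: dvdp_prod_coprime; first exact: index_enum_uniq.
    move=> i j ij; apply/coprimep_expl/coprimep_expr.
    apply: irreducible_monic_coprime; rewrite ?monic_map //.
    by apply: contra ij => /eqP/Pi_distinct->.
  by move=> i; rewrite (dvdp_trans _ (t_dvd i)) // dvdp_exp2l ?geq_minr.
have [U UE] := residue_poly_surj u.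
have PE : P = H * (H * W) + a *: T by rewrite HHW.
(* The chain is taken with G = HW and h = deg H. *)
apply: (chain_length dedR p_neq0 alpha_int minP a_in a_notin HWm sizeHW).
  apply: (quotient_locint dedR p_neq0 alpha_int minP a_in a_notin PE (U := U)).
  by rewrite -(bar_eq0E dedR p_neq0 a_in a_notin) rmorphB rmorphM /= -/bar uE UE subrr.
exact: (val_index_length dedR p_neq0 sepL alpha_int alpha_gen minP a_in a_notin).
Qed.
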